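(* Let $X=\ell_p(\mathbb{Z})$ $(1\le p<\infty)$ or $X=c_0(\mathbb{Z})$ over $\mathbb{K}\in\{\mathbb{R},\mathbb{C}\}$, let $w=(w(n))_{n\in\mathbb{Z}}$ be a bounded sequence in $\mathbb{K}$ with $\inf_{n\in\mathbb{Z}}|w(n)|>0$, and let $B_w$ be the bilateral weighted backward shift on $X$ given by $w$. Let $\mathrm{Per}(B_w)$ be the set of periodic points of $B_w$. Then one of the following happens: $\bullet$ $\mathrm{Per}(B_w)$ is dense in $X$, and in this case $B_w$ has the periodic shadowing property if and only if $B_w$ has the shadowing property; $\bullet$ $\mathrm{Per}(B_w)=\{0\}$, in which case, considering the conditions (i) $B_w$ has the periodic shadowing property; (ii) for every $\varepsilon>0$ there is $\delta>0$ such that for all $n\in\mathbb{N}$ and all $(y_i)_{i=1}^n\subset B(0,\delta)$ with $\sum_{i=0}^{n-1}B_w^{i+1}y_{n-i}\in B(0,\delta)$ we have $\sum_{i=0}^{k-1}B_w^{i}y_{k-i}\in B(0,\varepsilon)$ for all $1\le k\le n$; (iii) for every $\varepsilon>0$ there is $\delta>0$ such that for all integers $k\le l\le m$ at least one of the following holds: $$(a)\quad \left|\frac{\varepsilon}{w(l+1)\cdots w(m)}-\delta\sum_{i=0}^{m-(l+1)}\frac{1}{w(m)\cdots w(m-i)}\right|\ge\delta,$$ $$(b)\quad \left|w(k)\cdots w(l)\,\varepsilon-\delta\sum_{i=0}^{(l-1)-k}w(k)\cdots w(k+i)\right|\ge\delta;$$ we have $(i)\iff(ii)\implies(iii)$.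
   Context: $B_w((x_n)_{n\in\mathbb{Z}})=(w(n+1)x_{n+1})_{n\in\mathbb{Z}}$; under the assumptions on $w$ it is a bounded invertible operator on $X$. $B(0,r)$ is the open ball of radius $r$ around $0$. Empty products equal $1$ and empty sums equal $0$ (relevant when $m=l$ in (a) and $k=l$ in (b)). Let $T$ be an invertible bounded operator on a normed space $X$. A $\delta$-pseudotrajectory of $T$ is a sequence $(x_j)$ indexed by an interval of integers (at least two elements) with $\|Tx_j-x_{j+1}\|<\delta$ for all consecutive indices. A $\delta$-pseudotrajectory $(x_j)_{j\in\mathbb{Z}}$ is periodic if there is $p\in\mathbb{N}$ with $x_{j+p}=x_j$ for all $j\in\mathbb{Z}$. A point $x$ is periodic for $T$ if $T^px=x$ for some $p\in\mathbb{N}$. $T$ has the shadowing property if for every $\varepsilon>0$ there is $\delta>0$ such that for every $\delta$-pseudotrajectory $(x_j)_{j\in\mathbb{Z}}$ there is $x\in X$ with $\|x_j-T^jx\|<\varepsilon$ for all $j\in\mathbb{Z}$. $T$ has the periodic shadowing property if for every $\varepsilon>0$ there is $\delta>0$ such that for every periodic $\delta$-pseudotrajectory $(x_j)_{j\in\mathbb{Z}}$ there is a periodic point $x$ of $T$ with $\|x_j-T^jx\|<\varepsilon$ for all $j\in\mathbb{Z}$. *)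

(* Defs.v *)
From HB Require Import structures.
From mathcomp Require Import all_boot all_order all_algebra.
From mathcomp Require Import all_classical all_reals all_analysis.
From mathcomp Require Import complex ring.

Set Implicit Arguments.
Unset Strict Implicit.
Unset Printing Implicit Defensive.

Import Order.TTheory GRing.Theory Num.Theory.
Import numFieldNormedType.Exports.
Import ComplexField.Normc.

Local Open Scope classical_set_scope.
Local Open Scope ring_scope.
Local Open Scope complex_scope.

Inductive scalar_kind := RealScalars | ComplexScalars.

Definition scalar_field (R : realType) (F : scalar_kind) : numFieldType :=
  match F with
  | RealScalars => R
  | ComplexScalars => R[i]
  end.

(* The norm of a numFieldType takes its values in the field itself; [modulus]
   is the same absolute value seen in R, see [normr_modulus]. *)
Definition modulus (R : realType) (F : scalar_kind) : scalar_field R F -> R :=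
  match F return scalar_field R F -> R with
  | RealScalars => fun x : R => `|x|
  | ComplexScalars => fun z : R[i] => normc z
  end.

Definition of_real (R : realType) (F : scalar_kind) : R -> scalar_field R F :=
  match F return R -> scalar_field R F with
  | RealScalars => fun r : R => r
  | ComplexScalars => fun r : R => r%:C
  end.

Arguments modulus {R F} _.
Arguments of_real {R} F _.

Section scalar_fields.
Variables (R : realType) (F : scalar_kind).
Implicit Types (x y : scalar_field R F) (r s : R).

Lemma normr_modulus x : `|x| = of_real F (modulus x).
Proof. by case: F x => //= -[a b]. Qed.

Lemma modulus_ge0 x : 0 <= modulus x.
Proof. by case: F x => [x|[a b]] /=; rewrite ?normr_ge0 ?sqrtr_ge0. Qed.

Lemma modulus0 : modulus (0 : scalar_field R F) = 0.
Proof. by case: F => /=; [exact: normr0|exact: normc0]. Qed.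

Lemma modulus0_eq0 x : modulus x = 0 -> x = 0.
Proof. by case: F x => [x /eqP|x] /=; [rewrite normr_eq0 => /eqP|exact: eq0_normc]. Qed.

Lemma modulusD x y : modulus (x + y) <= modulus x + modulus y.
Proof. by case: F x y => x y /=; [exact: ler_normD|exact: le_normcD]. Qed.

Lemma modulusM x y : modulus (x * y) = modulus x * modulus y.
Proof. by case: F x y => x y /=; [exact: normrM|exact: normcM]. Qed.

Lemma modulusV x : modulus x^-1 = (modulus x)^-1.
Proof. by case: F x => x /=; [exact: normfV|exact: normcV]. Qed.

Lemma of_realD r s : of_real F (r + s) = of_real F r + of_real F s.
Proof. by case: F => //=; rewrite rmorphD. Qed.

Lemma of_realM r s : of_real F (r * s) = of_real F r * of_real F s.
Proof. by case: F => //=; rewrite rmorphM. Qed.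

Lemma of_real0 : of_real F (0 : R) = 0.
Proof. by case: F. Qed.

Lemma of_real_inj : injective (of_real F : R -> scalar_field R F).
Proof. by case: F => r s //= -[]. Qed.

Lemma ler_of_real r s : (of_real F r <= of_real F s) = (r <= s).
Proof. by case: F => //=; rewrite lecR. Qed.

Lemma ltr_of_real r s : (of_real F r < of_real F s) = (r < s).
Proof. by case: F => //=; rewrite ltcR. Qed.

End scalar_fields.

Inductive space_kind (R : realType) :=
  | Ell (p : R) of 1 <= p
  | CZero.
Arguments CZero {R}.

Section sequence_space.
Variables (R : realType) (F : scalar_kind).
Local Notation K := (scalar_field R F).
Implicit Types (x y : int -> K) (s : space_kind R).

Definition psum (p : R) x : \bar R :=
  \esum_(n in [set: int]) (modulus (x n) `^ p)%:E.

Definition in_seqspace s x : Prop :=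
  match s with
  | Ell p _ => (psum p x < +oo)%E
  | CZero => forall e : R, 0 < e ->
      exists N : nat, forall n : int, (N <= `|n|)%N -> modulus (x n) < e
  end.

Definition seqnorm s x : R :=
  match s with
  | Ell p _ => fine (psum p x) `^ p^-1
  | CZero => sup (range (fun n => modulus (x n)))
  end.

Definition seqspace_pred s : {pred int -> K} := fun x => `[< in_seqspace s x >].

Lemma in_seqspaceP s x : reflect (in_seqspace s x) (x \in seqspace_pred s).
Proof. exact: asboolP. Qed.

Lemma esum_ler (a : int -> \bar R) (b : \bar R) :
  (forall X : set int, finite_set X -> (\sum_(i \in X) a i <= b)%E) ->
  (\esum_(i in [set: int]) a i <= b)%E.
Proof. by move=> ab; apply: ge_ereal_sup => _ [X [finX _] <-]; exact: ab. Qed.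

Lemma esumZ_le (c : R) (a : int -> \bar R) : 0 <= c -> (forall i, (0 <= a i)%E) ->
  (\esum_(i in [set: int]) (c%:E * a i) <= c%:E * \esum_(i in [set: int]) a i)%E.
Proof.
move=> c0 a0; apply: esum_ler => X finX.
rewrite -ge0_mule_fsumr// lee_wpmul2l ?lee_fin//.
by apply: ereal_sup_ubound => /=; exists X.
Qed.

Lemma psum_ge0 p x : (0 <= psum p x)%E.
Proof. by apply: esum_ge0 => n _; rewrite lee_fin powR_ge0. Qed.

Lemma psum_term p x n : ((modulus (x n) `^ p)%:E <= psum p x)%E.
Proof.
have h i : (0 <= (modulus (x i) `^ p)%:E)%E by rewrite lee_fin powR_ge0.
rewrite -(@esum_set1 _ _ n (fun i => (modulus (x i) `^ p)%:E))//.
rewrite /psum esum_mkcond; apply: le_esum => i _.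
by case: ifP => // _; exact: h.
Qed.

Lemma psum_fin p x : (psum p x < +oo)%E -> psum p x = (fine (psum p x))%:E.
Proof. by move=> xp; rewrite fineK// ge0_fin_numE// psum_ge0. Qed.

Lemma fine_psum p (p1 : 1 <= p) x :
  seqnorm (Ell p1) x `^ p = fine (psum p x).
Proof.
have p0 : p != 0 by rewrite gt_eqF// (lt_le_trans _ p1).
by rewrite /= -powRrM mulVf// powRr1// fine_ge0// psum_ge0.
Qed.

Lemma c0_ubound x : in_seqspace CZero x ->
  has_sup (range (fun n => modulus (x n))).
Proof.
move=> /(_ 1 ltr01)[N xN]; split; first by exists (modulus (x 0)), 0.
exists (1 + \sum_(i < N) (modulus (x i%:Z) + modulus (x (- i%:Z)))).
move=> _ [n _ <-]; have [Nn|nN] := leqP N `|n|%N.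
  rewrite (le_trans (ltW (xN n Nn)))// lerDl sumr_ge0// => i _.
  by rewrite addr_ge0// modulus_ge0.
rewrite (bigD1 (Ordinal nN))//=.
have h : modulus (x n) <=
    modulus (x `|n|%N%:Z) + modulus (x (- `|n|%N%:Z)).
  case: n {nN} => n; first by rewrite absz_nat lerDl modulus_ge0.
  by rewrite NegzE abszN absz_nat lerDr modulus_ge0.
rewrite (le_trans h)// addrCA lerDl addr_ge0// sumr_ge0// => i _.
by rewrite addr_ge0// modulus_ge0.
Qed.

Lemma seqnorm_ge0 s x : in_seqspace s x -> 0 <= seqnorm s x.
Proof.
case: s => [p p1|] xs; first exact: powR_ge0.
rewrite (le_trans (modulus_ge0 (x 0)))//.
by apply: sup_upper_bound; [exact: c0_ubound|exists 0].
Qed.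

Lemma modulus_le_seqnorm s x n : in_seqspace s x -> modulus (x n) <= seqnorm s x.
Proof.
case: s => [p p1|] xs; last first.
  by apply: sup_upper_bound; [exact: c0_ubound|exists n].
have p0 : 0 < p by rewrite (lt_le_trans _ p1).
have := psum_term p x n; rewrite psum_fin// lee_fin -(fine_psum p1) => h.
rewrite -(@powRr1 _ (modulus _)) ?modulus_ge0//.
rewrite -[leRHS]powRr1 ?powR_ge0// -(mulfV (lt0r_neq0 p0)) 2!powRrM.
by rewrite ge0_ler_powR ?nnegrE ?powR_ge0// invr_ge0 ltW.
Qed.

(* domination up to a translation of the index *)
Lemma in_seqspace_dom s x y (M : R) (c : int) : 0 <= M -> in_seqspace s x ->
  (forall n, modulus (y n) <= M * modulus (x (n + c))) ->
  in_seqspace s y /\ seqnorm s y <= M * seqnorm s x.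
Proof.
move=> M0 xs yx; case: s xs => [p p1|] xs.
  have p0 : 0 < p by rewrite (lt_le_trans _ p1).
  have le1 : (psum p y <= (M `^ p)%:E * psum p x)%E.
    have -> : psum p x = \esum_(n in [set: int]) (modulus (x (n + c)) `^ p)%:E.
      rewrite /psum (@reindex_esum _ _ _ setT setT (fun n => n + c))//.
      split => //.
      - by move=> i j _ _; exact: addIr.
      - by move=> j _; exists (j - c) => //; rewrite subrK.
    apply: le_trans (esumZ_le (powR_ge0 _ _) _); last first.
      by move=> i; rewrite lee_fin powR_ge0.
    apply: le_esum => n _; rewrite -EFinM lee_fin -powRM ?modulus_ge0//.
    by rewrite ge0_ler_powR ?nnegrE ?modulus_ge0 ?mulr_ge0 ?modulus_ge0// ltW.
  have ys : (psum p y < +oo)%E.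
    by rewrite (le_lt_trans le1)// psum_fin// -EFinM ltry.
  split => //; move: le1; rewrite (psum_fin xs) (psum_fin ys) -EFinM lee_fin => h.
  have {1}-> : M = (M `^ p) `^ p^-1 by rewrite -powRrM mulfV ?gt_eqF// powRr1.
  rewrite /= -powRM ?powR_ge0 ?fine_ge0 ?psum_ge0//.
  rewrite ge0_ler_powR ?nnegrE ?invr_ge0 ?(ltW p0) ?fine_ge0 ?psum_ge0//.
  by rewrite mulr_ge0 ?powR_ge0 ?fine_ge0 ?psum_ge0.
have ys : in_seqspace CZero y.
  move=> e e0; have M1 : 0 < M + 1 by rewrite ltr_wpDl.
  have [N xN] := xs (e / (M + 1)) (divr_gt0 e0 M1).
  exists (N + `|c|)%N => n Nn; rewrite (le_lt_trans (yx n))//.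
  have {}xN : modulus (x (n + c)) < e / (M + 1).
    apply: xN; rewrite -(leq_add2r `|c|) (leq_trans Nn)//.
    by rewrite -{1}(addrK c n) (leq_trans (leqD_dist _ 0 _))// subr0 sub0r abszN.
  rewrite (@le_lt_trans _ _ ((M + 1) * modulus (x (n + c))))//.
    by rewrite ler_wpM2r ?modulus_ge0// lerDl.
  by rewrite mulrC -ltr_pdivlMr.
split => //; apply: ge_sup; first by exists (modulus (y 0)), 0.
move=> _ [n _ <-]; rewrite (le_trans (yx n))// ler_wpM2l//.
by rewrite (@modulus_le_seqnorm CZero).
Qed.

Lemma seqnorm_eq0 s x : in_seqspace s x -> seqnorm s x = 0 -> x = 0.
Proof.
move=> xs x0; apply/funext => n; apply: modulus0_eq0.
by apply/le_anti; rewrite modulus_ge0 -{1}x0 modulus_le_seqnorm.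
Qed.

Lemma minkowski_seq (p : R) (p1 : 1 <= p) x y :
  in_seqspace (Ell p1) x -> in_seqspace (Ell p1) y ->
  in_seqspace (Ell p1) (x + y) /\
  seqnorm (Ell p1) (x + y) <= seqnorm (Ell p1) x + seqnorm (Ell p1) y.
Proof.
move=> xs ys; have p0 : 0 < p by rewrite (lt_le_trans _ p1).
have [x0|xn0] := eqVneq (seqnorm (Ell p1) x) 0.
  by rewrite (seqnorm_eq0 xs x0) add0r lerDr seqnorm_ge0//; rewrite -(seqnorm_eq0 xs x0).
have [y0|yn0] := eqVneq (seqnorm (Ell p1) y) 0.
  by rewrite (seqnorm_eq0 ys y0) addr0 lerDl seqnorm_ge0//; rewrite -(seqnorm_eq0 ys y0).
set A := seqnorm _ x in xn0 *; set B := seqnorm _ y in yn0 *.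
have A0 : 0 < A by rewrite lt_neqAle eq_sym xn0 seqnorm_ge0.
have B0 : 0 < B by rewrite lt_neqAle eq_sym yn0 seqnorm_ge0.
have HA : A `^ p = fine (psum p x) by exact: fine_psum.
have HB : B `^ p = fine (psum p y) by exact: fine_psum.
clearbody A B.
have S0 : 0 < A + B by rewrite addr_gt0.
have A1 : A / (A + B) <= 1 by rewrite ler_pdivrMr// mul1r lerDl ltW.
have A2 : 0 <= A / (A + B) by rewrite divr_ge0// ltW.
have le1 n : modulus ((x + y) n) `^ p <=
    (A + B) `^ p * (A / (A + B) / A `^ p) * modulus (x n) `^ p +
    (A + B) `^ p * (B / (A + B) / B `^ p) * modulus (y n) `^ p.
  have := @convex_powR R p p1 (Itv01 A2 A1) (modulus (x n) / A) (modulus (y n) / B).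
  rewrite !inE/= !in_itv/= !divr_ge0 ?modulus_ge0 ?(ltW A0) ?(ltW B0)//.
  move=> /(_ isT isT); rewrite [X in (X `^ _ <= _) -> _]convRE [X in (_ <= X) -> _]convRE /unstable.onem /=.
  have -> : 1 - (A / (A + B)) = B / (A + B).
    by rewrite -[X in X - _](mulfV (lt0r_neq0 S0)) -mulrBl addrC addKr.
  have -> : A / (A + B) * (modulus (x n) / A) + B / (A + B) * (modulus (y n) / B)
      = (modulus (x n) + modulus (y n)) / (A + B).
    by field; rewrite xn0 yn0 (lt0r_neq0 S0).
  rewrite !powRM ?addr_ge0 ?modulus_ge0 ?invr_ge0 ?(ltW A0) ?(ltW B0) ?(ltW S0)//.
  have powRV c : 0 < c -> c^-1 `^ p = (c `^ p)^-1.
    move=> c0; have cp : c `^ p != 0 by rewrite gt_eqF ?powR_gt0.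
    apply: (mulfI cp); rewrite mulfV// -powRM ?invr_ge0 ?(ltW c0)//.
    by rewrite mulfV ?gt_eqF// powR1.
  rewrite !powRV// ler_pdivrMr ?powR_gt0// => h.
  rewrite (@le_trans _ _ ((modulus (x n) + modulus (y n)) `^ p))//.
    rewrite ge0_ler_powR ?nnegrE ?addr_ge0 ?modulus_ge0 ?modulusD//.
    exact: ltW.
  by rewrite (le_trans h)// le_eqVlt; apply/orP; left; apply/eqP; ring.
have cA : 0 <= (A + B) `^ p * (A / (A + B) / A `^ p).
  by rewrite mulr_ge0 ?powR_ge0// divr_ge0 ?powR_ge0.
have cB : 0 <= (A + B) `^ p * (B / (A + B) / B `^ p).
  by rewrite mulr_ge0 ?powR_ge0// divr_ge0 ?powR_ge0// divr_ge0 ?ltW.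
have le2 : (psum p (x + y)%R <= ((A + B) `^ p)%:E)%E.
  rewrite (@le_trans _ _ (((A + B) `^ p * (A / (A + B) / A `^ p))%:E * psum p x +
      ((A + B) `^ p * (B / (A + B) / B `^ p))%:E * psum p y)%E)//.
    apply: le_trans (leeD (esumZ_le cA _) (esumZ_le cB _)).
    - rewrite -esumD//.
      + by apply: le_esum => n _; rewrite -!EFinM -EFinD lee_fin.
      + by move=> n _; rewrite mule_ge0// lee_fin powR_ge0.
      + by move=> n _; rewrite mule_ge0// lee_fin powR_ge0.
    - by move=> n; rewrite lee_fin powR_ge0.
    - by move=> n; rewrite lee_fin powR_ge0.
  rewrite (psum_fin xs) (psum_fin ys) -!EFinM -EFinD lee_fin -HA -HB.
  have Ap : A `^ p != 0 by rewrite gt_eqF ?powR_gt0.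
  have Bp : B `^ p != 0 by rewrite gt_eqF ?powR_gt0.
  rewrite le_eqVlt; apply/orP; left; apply/eqP; field.
  by rewrite (lt0r_neq0 S0) Ap Bp.
have xys : (psum p (x + y)%R < +oo)%E by rewrite (le_lt_trans le2) ?ltry.
split=> //; move: le2; rewrite (psum_fin xys) lee_fin -(fine_psum p1) => h.
rewrite -[leLHS]powRr1 ?powR_ge0// -[leRHS]powRr1 ?(ltW S0)//.
rewrite -(mulfV (lt0r_neq0 p0)) 2!powRrM.
by rewrite ge0_ler_powR ?nnegrE ?powR_ge0// invr_ge0 ltW.
Qed.

Lemma in_seqspaceD s x y : in_seqspace s x -> in_seqspace s y ->
  in_seqspace s (x + y) /\ seqnorm s (x + y) <= seqnorm s x + seqnorm s y.
Proof.
case: s => [p p1|] xs ys; first exact: minkowski_seq.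
have xys : in_seqspace CZero (x + y).
  move=> e e0; have e20 : 0 < e / 2 by rewrite divr_gt0.
  have [[N xN] [N' yN]] := (xs _ e20, ys _ e20).
  exists (maxn N N') => n; rewrite geq_max => /andP[/xN xn /yN yn].
  by rewrite (le_lt_trans (modulusD _ _))// [e]splitr ltrD.
split => //; apply: ge_sup; first by exists (modulus ((x + y) 0)), 0.
move=> _ [n _ <-]; rewrite (le_trans (modulusD _ _))// lerD//.
- exact: (@modulus_le_seqnorm CZero).
- exact: (@modulus_le_seqnorm CZero).
Qed.

Lemma in_seqspace0 s : in_seqspace s 0.
Proof.
case: s => [p p1|e e0] /=; last by exists 0%N => n _; rewrite modulus0.
have p0 : p != 0 by rewrite gt_eqF// (lt_le_trans _ p1).
rewrite /psum esum1 ?ltry// => n _.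
by rewrite modulus0 powR0.
Qed.

Lemma in_seqspaceZ s (a : K) x : in_seqspace s x ->
  in_seqspace s (a *: x) /\ seqnorm s (a *: x) <= modulus a * seqnorm s x.
Proof.
move=> xs; apply: (in_seqspace_dom (c := 0) (modulus_ge0 a) xs) => n.
by rewrite addr0 -modulusM.
Qed.

Lemma seqnormZ s (a : K) x : in_seqspace s x ->
  seqnorm s (a *: x) = modulus a * seqnorm s x.
Proof.
move=> xs; have [axs le1] := in_seqspaceZ a xs; apply/le_anti; rewrite le1 /=.
have [->|a0] := eqVneq a 0; first by rewrite modulus0 mul0r scale0r seqnorm_ge0//; exact: in_seqspace0.
have [_] := in_seqspaceZ a^-1 axs; rewrite scalerA mulVf// scale1r modulusV.
rewrite ler_pdivlMl// lt_neqAle modulus_ge0 andbT eq_sym.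
by apply: contra a0 => /eqP /modulus0_eq0 ->.
Qed.

Lemma seqspace_submod s : submod_closed (seqspace_pred s).
Proof.
split; first exact/in_seqspaceP/in_seqspace0.
move=> a x y /in_seqspaceP xs /in_seqspaceP ys; apply/in_seqspaceP.
by apply: (in_seqspaceD _ ys).1; exact: (in_seqspaceZ a xs).1.
Qed.

HB.instance Definition _ s :=
  GRing.isSubmodClosed.Build K (int -> K) (seqspace_pred s) (seqspace_submod s).

Record seqspace s := SeqSpace {
  seqval :> int -> K;
  seqvalP : seqval \in seqspace_pred s
}.

HB.instance Definition _ s := [isSub for @seqval s].
HB.instance Definition _ s := [Choice of seqspace s by <:].
HB.instance Definition _ s := [SubChoice_isSubLmodule of seqspace s by <:].

Lemma seqspace_in s (x : seqspace s) : in_seqspace s x.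
Proof. exact/in_seqspaceP/seqvalP. Qed.

Definition seqspace_norm s (x : seqspace s) : K := of_real F (seqnorm s x).

Lemma seqspace_normD s (x y : seqspace s) :
  seqspace_norm (x + y) <= seqspace_norm x + seqspace_norm y.
Proof.
rewrite /seqspace_norm -of_realD ler_of_real.
exact: (in_seqspaceD (seqspace_in x) (seqspace_in y)).2.
Qed.

Lemma seqspace_normZ s (a : K) (x : seqspace s) :
  seqspace_norm (a *: x) = `|a| * seqspace_norm x.
Proof.
by rewrite normr_modulus -of_realM -seqnormZ//; exact: seqspace_in.
Qed.

Lemma seqspace_norm_eq0 s (x : seqspace s) : seqspace_norm x = 0 -> x = 0.
Proof.
rewrite -(of_real0 R F) => /of_real_inj x0; apply/val_inj => /=.
exact: (seqnorm_eq0 (seqspace_in x)).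
Qed.

HB.instance Definition _ s := @Lmodule_isNormed.Build K (seqspace s)
  (@seqspace_norm s) (@seqspace_normD s) (@seqspace_normZ s) (@seqspace_norm_eq0 s).

Lemma seqspace_normE s (x : seqspace s) : `|x| = of_real F (seqnorm s x).
Proof. by []. Qed.

End sequence_space.


Record invertible_operator (K : numFieldType) (X : normedModType K) :=
  InvertibleOperator {
    iop :> {linear X -> X};
    iop_inv : {linear X -> X};
    iopK : cancel iop iop_inv;
    iop_invK : cancel iop_inv iop;
    iop_bounded : exists M : K, forall x, `|iop x| <= M * `|x|;
    iop_inv_bounded : exists M : K, forall x, `|iop_inv x| <= M * `|x|
  }.

Section dynamics.
Variables (K : numFieldType) (X : normedModType K).
Variable T : invertible_operator X.

Definition opow (j : int) : X -> X :=
  match j with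
  | Posz n => iter n T
  | Negz n => iter n.+1 (iop_inv T)
  end.

Definition pseudotrajectory (d : K) (x : int -> X) :=
  forall j, `|T (x j) - x (j + 1)| < d.

Definition periodic_seq (x : int -> X) :=
  exists2 p : nat, (0 < p)%N & forall j, x (j + p%:Z) = x j.

Definition periodic_point (a : X) :=
  exists2 p : nat, (0 < p)%N & iter p T a = a.

Definition Per : set X := [set a | periodic_point a].

(* For K = R[i], [0 < e] forces e to be a positive real. *)
Definition shadowing := forall e : K, 0 < e -> exists2 d : K, 0 < d &
  forall x : int -> X, pseudotrajectory d x ->
    exists a : X, forall j, `|x j - opow j a| < e.

Definition periodic_shadowing := forall e : K, 0 < e -> exists2 d : K, 0 < d &
  forall x : int -> X, pseudotrajectory d x -> periodic_seq x ->
    exists2 a : X, periodic_point a & forall j, `|x j - opow j a| < e.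

Definition small_orbit_condition := forall e : K, 0 < e -> exists2 d : K, 0 < d &
  forall (n : nat) (y : nat -> X), (0 < n)%N ->
    (forall i, (1 <= i <= n)%N -> ball 0 d (y i)) ->
    ball 0 d (\sum_(0 <= i < n) iter i.+1 T (y (n - i)%N)) ->
    forall k, (1 <= k <= n)%N ->
      ball 0 e (\sum_(0 <= i < k) iter i T (y (k - i)%N)).

End dynamics.

(* For k <= l <= m, w(l+1)...w(m) has m - l factors, w(k)...w(l) has l - k + 1,
   and a sum over i = 0, ..., (m - l) - 1 is empty when m = l. *)
Definition weight_condition (K : numFieldType) (w : int -> K) :=
  forall e : K, 0 < e -> exists2 d : K, 0 < d &
  forall k l m : int, k <= l -> l <= m ->
    d <= `| e / (\prod_(0 <= j < `|m - l|) w (l + 1 + j%:Z))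
            - d * \sum_(0 <= i < `|m - l|)
                     (\prod_(0 <= j < i.+1) w (m - j%:Z))^-1 |
    \/
    d <= `| (\prod_(0 <= j < `|l - k|.+1) w (k + j%:Z)) * e
            - d * \sum_(0 <= i < `|l - k|)
                     \prod_(0 <= j < i.+1) w (k + j%:Z) |.

Section weighted_shift.
Variables (R : realType) (F : scalar_kind) (s : space_kind R).
Local Notation K := (scalar_field R F).
Local Notation X := (seqspace F s).
Variable w : int -> K.

Definition bounded_weight := has_ubound (range (fun n => modulus (w n))).
Definition bounded_below_weight := 0 < inf (range (fun n => modulus (w n))).

Hypotheses (wb : bounded_weight) (wi : bounded_below_weight).

Definition bshift_seq (x : int -> K) : int -> K := fun n => w (n + 1) * x (n + 1).

Definition bshift_inv_seq (x : int -> K) : int -> K :=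
  fun n => (w n)^-1 * x (n - 1).

Let M := xget 0 [set r : R | 0 <= r /\ forall n, modulus (w n) <= r].

Let MP : 0 <= M /\ forall n, modulus (w n) <= M.
Proof.
apply: (@xgetPex _ 0 [set r : R | 0 <= r /\ forall n, modulus (w n) <= r]).
case: wb => r wr; exists r; split => [|n]; last by apply: wr; exists n.
by rewrite (le_trans (modulus_ge0 (w 0)))//; apply: wr; exists 0.
Qed.

Let m := inf (range (fun n => modulus (w n))).

Let m_le n : m <= modulus (w n).
Proof.
by apply: ge_inf; [exists 0 => _ [k _ <-]; exact: modulus_ge0|exists n].
Qed.

Lemma weight_neq0 n : w n != 0.
Proof.
apply/eqP => wn0; have := lt_le_trans wi (m_le n).
by rewrite wn0 modulus0 ltxx.
Qed.

Lemma bshift_dom (x : int -> K) : in_seqspace s x ->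
  in_seqspace s (bshift_seq x) /\ seqnorm s (bshift_seq x) <= M * seqnorm s x.
Proof.
move=> xs; apply: (in_seqspace_dom (c := 1) MP.1 xs) => n.
by rewrite modulusM ler_wpM2r ?modulus_ge0// MP.2.
Qed.

Lemma bshift_inv_dom (x : int -> K) : in_seqspace s x ->
  in_seqspace s (bshift_inv_seq x) /\
  seqnorm s (bshift_inv_seq x) <= m^-1 * seqnorm s x.
Proof.
move=> xs; have m0 : 0 <= m^-1 by rewrite invr_ge0 ltW.
apply: (in_seqspace_dom (c := -1) m0 xs) => n.
rewrite modulusM modulusV ler_wpM2r ?modulus_ge0//.
by rewrite lef_pV2 ?posrE// (lt_le_trans wi (m_le n)).
Qed.

Definition bshift_fun (x : X) : X :=
  SeqSpace (introT (in_seqspaceP s _) (bshift_dom (seqspace_in x)).1).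

Definition bshift_inv_fun (x : X) : X :=
  SeqSpace (introT (in_seqspaceP s _) (bshift_inv_dom (seqspace_in x)).1).

Lemma bshift_linear : linear bshift_fun.
Proof.
move=> a x y; apply/val_inj/funext => n /=.
by rewrite /bshift_seq /= mulrDr mulrCA.
Qed.

Lemma bshift_inv_linear : linear bshift_inv_fun.
Proof.
move=> a x y; apply/val_inj/funext => n /=.
by rewrite /bshift_inv_seq /= mulrDr mulrCA.
Qed.

HB.instance Definition _ := GRing.isLinear.Build K X X _ bshift_fun bshift_linear.
HB.instance Definition _ :=
  GRing.isLinear.Build K X X _ bshift_inv_fun bshift_inv_linear.

Lemma bshiftK : cancel bshift_fun bshift_inv_fun.
Proof.
move=> x; apply/val_inj/funext => n /=.
by rewrite /bshift_inv_seq /= /bshift_seq subrK mulKf ?weight_neq0.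
Qed.

Lemma bshift_invK : cancel bshift_inv_fun bshift_fun.
Proof.
move=> x; apply/val_inj/funext => n /=.
by rewrite /bshift_seq /= /bshift_inv_seq addrK mulVKf ?weight_neq0.
Qed.

Lemma bshift_bounded : exists C : K, forall x : X, `|bshift_fun x| <= C * `|x|.
Proof.
exists (of_real F M) => x; rewrite -of_realM ler_of_real.
exact: (bshift_dom (seqspace_in x)).2.
Qed.

Lemma bshift_inv_bounded :
  exists C : K, forall x : X, `|bshift_inv_fun x| <= C * `|x|.
Proof.
exists (of_real F m^-1) => x; rewrite -of_realM ler_of_real.
exact: (bshift_inv_dom (seqspace_in x)).2.
Qed.

Definition bshift : invertible_operator X :=
  @InvertibleOperator K X bshift_fun bshift_inv_fun
    bshiftK bshift_invK bshift_bounded bshift_inv_bounded.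

Lemma bshiftE (x : X) n : bshift x n = w (n + 1) * x (n + 1).
Proof. by []. Qed.

End weighted_shift.

(* Main.v *)
(* Idea. Let [v] be the two-sided sequence with [B v = v] and [v 0 = 1]. The
   periodic sequences of [B] are the products of [v] with periodic scalars, so
   [Per B] is dense if [v] lies in the space and trivial otherwise.

   If [v] lies in the space, a pseudotrajectory carried by a single diagonal
   ("ray"), brought back to [0] at a time when [v] is small, is part of a periodic
   one. Shadowing these gives
   [\sum_(a <= i < b) 1/|v i| <= C (1/|v a| + 1/|v b|)], hence [1/|v|] grows
   exponentially at both ends. This is an exponential dichotomy of [B], and an
   explicit Green function corrects every pseudotrajectory into an orbit, which
   is periodic when the pseudotrajectory is; so both shadowing properties are
   equivalent to the dichotomy.

   Condition (ii) says that pseudotrajectories leaving [0] and returning to [0]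
   ("loops") stay small. Such a loop extends periodically; conversely a periodic
   pseudotrajectory becomes a loop after multiplication by a slow ramp. The failure
   of (a) and (b) lets a ray climb from [0] to norm [eps] and come back. *)
Require Import Defs.
From mathcomp Require Import all_boot all_order all_algebra.
From mathcomp Require Import all_classical all_reals all_analysis.
From mathcomp Require Import complex ring lra zify.

Set Implicit Arguments.
Unset Strict Implicit.
Unset Printing Implicit Defensive.

Import Order.TTheory GRing.Theory Num.Theory.
Import numFieldNormedType.Exports.

Local Open Scope classical_set_scope.
Local Open Scope ring_scope.

(** * Real tolerances and moduli for both scalar fields *)

Section scalars.
Variables (R : realType) (F : scalar_kind).
Local Notation K := (scalar_field R F).

Lemma of_real1 : of_real F (1 : R) = 1.
Proof. by case: F. Qed.

Lemma of_realN (r : R) : of_real F (- r) = - of_real F r.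
Proof. by case: F => //=; rewrite rmorphN. Qed.

Lemma of_realB (r t : R) : of_real F (r - t) = of_real F r - of_real F t.
Proof. by rewrite of_realD of_realN. Qed.

Lemma modulus_of_real (r : R) : modulus (of_real F r) = `|r|.
Proof. by case: F => //=; rewrite /Normc.normc expr0n addr0 sqrtr_sqr. Qed.

Lemma modulusN (x : K) : modulus (- x) = modulus x.
Proof. by apply: (@of_real_inj R F); rewrite -!normr_modulus normrN. Qed.

Lemma modulusB (x y : K) : modulus x - modulus y <= modulus (x - y).
Proof.
by rewrite lerBlDr (le_trans _ (modulusD _ _))// subrK.
Qed.

Lemma modulus_gt0 (x : K) : x != 0 -> 0 < modulus x.
Proof.
move=> x0; rewrite lt_neqAle modulus_ge0 andbT eq_sym.
by apply: contra x0 => /eqP /modulus0_eq0 ->.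
Qed.

Lemma modulus_sum (n : nat) (f : nat -> K) :
  modulus (\sum_(i < n) f i) <= \sum_(i < n) modulus (f i).
Proof.
elim: n => [|n IH]; first by rewrite !big_ord0 modulus0.
by rewrite !big_ord_recr /= (le_trans (modulusD _ _))// lerD2r.
Qed.

Lemma gt0_of_real (e : K) : 0 < e -> exists2 r : R, 0 < r & e = of_real F r.
Proof.
move=> e0; exists (modulus e); last by rewrite -normr_modulus gtr0_norm.
by rewrite modulus_gt0// gt_eqF.
Qed.

Lemma of_real_gt0 (r : R) : (0 < of_real F r) = (0 < r).
Proof. by rewrite -(of_real0 R F) ltr_of_real. Qed.

(** In [R[i]] too a positive element is real, so the tolerances of the definitions, which range over
    the scalar field, may be taken in [R]. *)
Lemma forall_exists_of_real (P : K -> K -> Prop) :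
  (forall e, 0 < e -> exists2 d, 0 < d & P e d) <->
  (forall e : R, 0 < e -> exists2 d : R, 0 < d & P (of_real F e) (of_real F d)).
Proof.
split=> h e e0; last first.
  have [r r0 ->] := gt0_of_real e0; have [d d0 Pd] := h _ r0.
  by exists (of_real F d) => //; rewrite of_real_gt0.
have [|d d0 Pd] := h (of_real F e); first by rewrite of_real_gt0.
by have [r r0 rE] := gt0_of_real d0; exists r => //; rewrite -rE.
Qed.

End scalars.

(** * The norm with values in [R], and sequences supported at one point *)

Section real_norm.
Variables (R : realType) (F : scalar_kind) (s : space_kind R).
Local Notation K := (scalar_field R F).
Local Notation X := (seqspace F s).

Definition rnorm (x : X) : R := seqnorm s x.

Lemma rnorm_lt (x : X) (r : R) : (`|x| < of_real F r) = (rnorm x < r).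
Proof. by rewrite seqspace_normE ltr_of_real. Qed.

Lemma rnorm_ge0 (x : X) : 0 <= rnorm x.
Proof. exact/seqnorm_ge0/seqspace_in. Qed.

Lemma rnorm0 : rnorm 0 = 0.
Proof.
by apply: (@of_real_inj R F); rewrite -seqspace_normE normr0 of_real0.
Qed.

Lemma rnormD (x y : X) : rnorm (x + y) <= rnorm x + rnorm y.
Proof. exact: (in_seqspaceD (seqspace_in x) (seqspace_in y)).2. Qed.

Lemma rnormZ (a : K) (x : X) : rnorm (a *: x) = modulus a * rnorm x.
Proof. exact: (seqnormZ a (seqspace_in x)). Qed.

Lemma rnormN (x : X) : rnorm (- x) = rnorm x.
Proof. by apply: (@of_real_inj R F); rewrite -!seqspace_normE normrN. Qed.

Lemma rnormB (x y : X) : rnorm (x - y) <= rnorm x + rnorm y.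
Proof. by rewrite -(rnormN y) rnormD. Qed.

Lemma rnorm_subC (x y : X) : rnorm (x - y) = rnorm (y - x).
Proof. by rewrite -rnormN opprB. Qed.

Lemma modulus_le_rnorm (x : X) n : modulus (x n) <= rnorm x.
Proof. exact/modulus_le_seqnorm/seqspace_in. Qed.

Lemma seqspaceP (x y : X) : (forall n, x n = y n) -> x = y.
Proof. by move=> xy; apply/val_inj/funext. Qed.

Lemma seqspaceDE (x y : X) n : (x + y) n = x n + y n. Proof. by []. Qed.
Lemma seqspaceBE (x y : X) n : (x - y) n = x n - y n. Proof. by []. Qed.
Lemma seqspaceZE (a : K) (x : X) n : (a *: x) n = a * x n. Proof. by []. Qed.
Lemma seqspace0E n : (0 : X) n = 0. Proof. by []. Qed.
Lemma seqspace_sumE (f : nat -> X) N n :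
  (\sum_(k < N) f k) n = \sum_(k < N) f k n.
Proof.
elim: N => [|N IH]; first by rewrite !big_ord0.
by rewrite !big_ord_recr seqspaceDE IH.
Qed.

Lemma rnorm_sum (f : nat -> X) N :
  rnorm (\sum_(k < N) f k) <= \sum_(k < N) rnorm (f k).
Proof.
elim: N => [|N IH]; first by rewrite !big_ord0 rnorm0.
by rewrite !big_ord_recr /= (le_trans (rnormD _ _))// lerD2r.
Qed.

Lemma seqspace_dom (y : int -> K) (M : R) (c : int) (x : X) : 0 <= M ->
  (forall n, modulus (y n) <= M * modulus (x (n + c))) ->
  exists2 z : X, (forall n, z n = y n) & rnorm z <= M * rnorm x.
Proof.
move=> M0 yx; have [ys le] := in_seqspace_dom M0 (seqspace_in x) yx.
by exists (SeqSpace (introT (in_seqspaceP s _) ys)).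
Qed.

Definition delta_seq (a : K) (m : int) : int -> K :=
  fun n => if n == m then a else 0.

Lemma delta_seq_in (a : K) (m : int) : in_seqspace s (delta_seq a m) /\
  seqnorm s (delta_seq a m) <= modulus a.
Proof.
rewrite /delta_seq; case: s => [p p1|].
  have p0 : 0 < p by rewrite (lt_le_trans _ p1).
  have psE : psum p (delta_seq a m) = (modulus a `^ p)%:E.
    rewrite -(@esum_set1 _ _ m (fun=> (modulus a `^ p)%:E)) ?lee_fin ?powR_ge0//.
    rewrite /psum [RHS]esum_mkcond; apply: eq_esum => i _.
    rewrite /delta_seq; have [->|im] := eqVneq i m.
      by rewrite mem_set.
    rewrite modulus0 powR0 ?gt_eqF// memNset//.
    by move=> /= /eqP; rewrite (negbTE im).
  split; first by rewrite /= psE ltry.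
  by rewrite /= psE /= -powRrM mulfV ?gt_eqF// powRr1// modulus_ge0.
have h n : modulus (if n == m then a else 0) <= modulus a.
  by case: ifP => _ //; rewrite modulus0 modulus_ge0.
split; last first.
  by apply: ge_sup => [|_ [n _ <-]]; [exists (modulus (if 0 == m then a else 0)), 0|].
move=> e e0; exists `|m|.+1 => n nm; case: eqP => [nE|]; last by rewrite modulus0.
by move: nm; rewrite nE ltnn.
Qed.

Definition delta (a : K) (m : int) : X :=
  SeqSpace (introT (in_seqspaceP s _) (delta_seq_in a m).1).

Lemma deltaE a m n : delta a m n = if n == m then a else 0.
Proof. by []. Qed.

Lemma rnorm_delta a m : rnorm (delta a m) <= modulus a.
Proof. exact: (delta_seq_in a m).2. Qed.

End real_norm.

(** * Loops, condition (ii) and periodic shadowing for a general operator *)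

Section loops.
Variables (R : realType) (F : scalar_kind) (s : space_kind R).
Local Notation K := (scalar_field R F).
Local Notation X := (seqspace F s).
Variable T : invertible_operator X.

Definition loop (d : R) (n : nat) (z : nat -> X) :=
  [/\ z 0%N = 0, z n = 0 & forall j, (j < n)%N -> rnorm (T (z j) - z j.+1) < d].

Definition small_loops := forall e : R, 0 < e -> exists2 d : R, 0 < d &
  forall n z, loop d n z -> forall k, (k <= n)%N -> rnorm (z k) < e.

Lemma pseudotrajectory_rnorm (d : R) (x : int -> X) :
  pseudotrajectory T (of_real F d) x <->
  forall j, rnorm (T (x j) - x (j + 1)) < d.
Proof. by split=> h j; have := h j; rewrite rnorm_lt. Qed.

Lemma shadowing_rnorm : shadowing T <->
  forall e : R, 0 < e -> exists2 d : R, 0 < d &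
    forall x : int -> X, (forall j, rnorm (T (x j) - x (j + 1)) < d) ->
      exists a : X, forall j, rnorm (x j - opow T j a) < e.
Proof.
rewrite /shadowing forall_exists_of_real.
split=> h e e0; have [d d0 H] := h e e0; exists d => // x.
  move=> /pseudotrajectory_rnorm/H [a ax]; exists a => j.
  by rewrite -rnorm_lt ax.
move=> /pseudotrajectory_rnorm/H [a ax]; exists a => j.
by rewrite rnorm_lt ax.
Qed.

Lemma periodic_shadowing_rnorm : periodic_shadowing T <->
  forall e : R, 0 < e -> exists2 d : R, 0 < d &
    forall x : int -> X, (forall j, rnorm (T (x j) - x (j + 1)) < d) ->
      periodic_seq x ->
      exists2 a : X, periodic_point T a & forall j, rnorm (x j - opow T j a) < e.
Proof.
rewrite /periodic_shadowing forall_exists_of_real.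
split=> h e e0; have [d d0 H] := h e e0; exists d => // x.
  move=> /pseudotrajectory_rnorm/H xH /xH [a aP ax]; exists a => // j.
  by rewrite -rnorm_lt ax.
move=> /pseudotrajectory_rnorm/H xH /xH [a aP ax]; exists a => // j.
by rewrite rnorm_lt ax.
Qed.

Lemma orbit_sumS (y : nat -> X) k :
  \sum_(0 <= i < k.+1) iter i T (y (k.+1 - i)%N) =
  y k.+1 + T (\sum_(0 <= i < k) iter i T (y (k - i)%N)).
Proof.
by rewrite big_nat_recl//= subn0 raddf_sum.
Qed.

Lemma ball0_rnorm (d : R) (x : X) : ball 0 (of_real F d) x <-> rnorm x < d.
Proof. by rewrite -ball_normE /ball_ /= sub0r normrN rnorm_lt. Qed.

(** With [z 0 = 0] and [z k = T (z k.-1) + y k], the sum to be bounded in (ii) is [z k], and the sum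
    assumed small there is [T (z n)]: its smallness permits a jump back to [0] at time [n + 1]. *)
Lemma small_orbit_loops : small_orbit_condition T <-> small_loops.
Proof.
rewrite /small_orbit_condition forall_exists_of_real.
split=> h e e0; have [d d0 H] := h e e0; exists d => //.
  move=> [|[|n]] z [z0 zn zd] k kn.
  - by move: kn; rewrite leqn0 => /eqP ->; rewrite z0 rnorm0.
  - by case: k kn => [|[|]]// _; rewrite ?z0 ?zn rnorm0.
  pose y i := if i is i'.+1 then z i - T (z i') else 0.
  have yz m : \sum_(0 <= i < m) iter i T (y (m - i)%N) = z m.
    elim: m => [|m IH]; first by rewrite big_nil z0.
    by rewrite orbit_sumS IH subrK.
  case: k kn => [|k]; first by rewrite z0 rnorm0.
  rewrite leq_eqVlt => /predU1P[->|kn]; first by rewrite zn rnorm0.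
  rewrite -yz; apply/ball0_rnorm; apply: (H n.+1 y) => //.
  - move=> [|i]// /andP[_ iN]; apply/ball0_rnorm; rewrite rnorm_subC.
    by apply: zd; rewrite (leq_trans iN).
  - apply/ball0_rnorm.
    have -> : \sum_(0 <= i < n.+1) iter i.+1 T (y (n.+1 - i)%N) = T (z n.+1).
      by rewrite -yz raddf_sum.
    by rewrite -[X in rnorm X]subr0 -zn zd.
move=> n y n0 yd Tyd k /andP[k0 kn].
apply/ball0_rnorm.
(* The value [0] beyond [n] closes the loop at time [n + 1]. *)
pose z k := if (k <= n)%N then \sum_(0 <= i < k) iter i T (y (k - i)%N) else 0.
have -> : \sum_(0 <= i < k) iter i T (y (k - i)%N) = z k by rewrite /z kn.
apply: (H n.+1 z) => //; last exact: leqW.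
split; first by rewrite /z big_nil.
- by rewrite /z ltnn.
move=> j; rewrite ltnS => jn; rewrite /z jn; case: ifP => jn1.
  rewrite orbit_sumS opprD addrCA subrr addr0 rnormN.
  by apply/ball0_rnorm/yd.
have -> : j = n by apply/eqP; rewrite eqn_leq jn leqNgt jn1.
by rewrite subr0 raddf_sum; apply/ball0_rnorm.
Qed.

(** The loop is repeated with period [n + 1]; there is no extra jump at the seam, since [z n.+1] and
    [z 0] are both [0]. *)
Lemma loop_pseudotrajectory d n z : 0 < d -> loop d n.+1 z ->
  exists x : int -> X, [/\ forall j, rnorm (T (x j) - x (j + 1)) < d,
    periodic_seq x & forall j, (j <= n)%N -> x j%:Z = z j].
Proof.
move=> d0 [z0 zn zd].
pose x (j : int) := z `|(j %% n.+1%:Z)%Z|%N.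
exists x; split.
- move=> j; rewrite /x.
  have : (0 <= j %% n.+1%:Z)%Z by rewrite modz_ge0.
  have : (j %% n.+1%:Z < n.+1%:Z)%Z by rewrite ltz_pmod.
  rewrite -modzDml; move: (j %% n.+1%:Z)%Z => [i|//]; rewrite ltz_nat => iN _.
  rewrite -PoszD addn1 modz_nat !absz_nat.
  move: iN; rewrite leq_eqVlt => /predU1P[iN|iN].
    by rewrite iN modnn z0 -zn -iN zd// iN.
  by rewrite modn_small// zd// ltnW.
- by exists n.+1 => // j; rewrite /x modzDr.
- by move=> j jn; rewrite /x modz_nat absz_nat modn_small.
Qed.

(** The only periodic orbit available for shadowing the repeated loop is [0], and closeness to it is
    smallness. *)
Lemma periodic_shadowing_small_loops : Per T = [set 0] ->
  periodic_shadowing T -> small_loops.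
Proof.
move=> T0 /periodic_shadowing_rnorm h e e0; have [d d0 H] := h e e0.
exists d => // -[|n] z zl k kn.
  by case: zl => z0 _ _; move: kn; rewrite leqn0 => /eqP ->; rewrite z0 rnorm0.
move: kn; rewrite leq_eqVlt => /predU1P[->|kn].
  by case: zl => _ -> _; rewrite rnorm0.
have [x [xd xp xz]] := loop_pseudotrajectory d0 zl.
have [a ap ax] := H x xd xp.
have a0 : a = 0 by have : Per T a := ap; rewrite T0.
rewrite -xz//; have := ax k%:Z.
have -> : opow T k%:Z a = 0.
  by rewrite a0 /=; elim: (k) => //= i ->; rewrite raddf0.
by rewrite subr0.
Qed.

(* A periodic pseudotrajectory becomes a loop after multiplication by a slow
   ramp from 0 to 1 and back to 0, and the ramp is 1 on a whole period. *)
Lemma small_loops_periodic_shadowing : small_loops -> periodic_shadowing T.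
Proof.
move=> h; apply/periodic_shadowing_rnorm => e e0; have [d d0 H] := h e e0.
exists (d / 2); first by rewrite divr_gt0.
move=> x xd [p p0 xp].
have xpn j n : x (j + (n * p)%N%:Z) = x j.
  elim: n => [|n IH]; first by rewrite addr0.
  by rewrite mulSn addnC PoszD addrA xp IH.
exists 0; first by exists 1%N => //=; rewrite raddf0.
suff xe : forall j, rnorm (x j) < e.
  move=> j; have -> : opow T j 0 = 0; last by rewrite subr0.
  by case: j => n /=; elim: n => [|n /= ->] //=; rewrite raddf0.
pose M : R := \sum_(j < p) rnorm (T (x j%:Z)).
have xM k : rnorm (T (x k%:Z)) <= M.
  rewrite {1}(divn_eq k p) addnC PoszD xpn /M.
  rewrite (bigD1 (Ordinal (ltn_pmod k p0)))//= lerDl sumr_ge0// => i _.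
  exact: rnorm_ge0.
have M0 : 0 <= M by apply: le_trans (xM 0%N); exact: rnorm_ge0.
(* The ramp has slope at most [1 / N], so it adds at most [M / N] to a jump; the other half of [d]
   is left for the jump of [x]. *)
pose N := (Num.truncn (M / (d / 2))).+1.
have MN : M / N%:R < d / 2.
  rewrite ltr_pdivrMr ?ltr0n// mulrC -ltr_pdivrMr ?divr_gt0//.
  exact: truncnS_gt.
pose n := (N + p + N)%N.
(* [N] steps up, a plateau of height [N] over [p] steps, [N] steps down. *)
pose t k : nat := minn N (minn k (n - k)%N).
pose tr k : R := (t k)%:R / N%:R.
pose z k : X := of_real F (tr k) *: x k%:Z.
have N0 : 0 < N%:R :> R by rewrite ltr0n.
have tr1 k : 0 <= tr k <= 1.
  rewrite /tr divr_ge0//= ler_pdivrMr// mul1r ler_nat /t geq_min leqnn//.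
have zl : loop d n z.
  split.
  - by rewrite /z /tr /t min0n minn0 mul0r of_real0 scale0r.
  - by rewrite /z /tr /t subnn !minn0 mul0r of_real0 scale0r.
  move=> j jn; rewrite /z linearZ /=.
  have -> : of_real F (tr j) *: T (x j%:Z) - of_real F (tr j.+1) *: x j.+1%:Z =
     of_real F (tr j.+1) *: (T (x j%:Z) - x (j%:Z + 1)) +
     of_real F (tr j - tr j.+1) *: T (x j%:Z).
    rewrite of_realB scalerBl scalerBr -addn1 PoszD.
    by rewrite [RHS]addrC addrA subrK.
  rewrite (le_lt_trans (rnormD _ _))// !rnormZ !modulus_of_real.
  rewrite [d]splitr ltr_leD//.
    have /andP[t0 t1] := tr1 j.+1.
    by rewrite ger0_norm// (le_lt_trans _ (xd j))// ler_piMl// rnorm_ge0.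
  rewrite (le_trans _ (ltW MN))// mulrC ler_pM ?rnorm_ge0//.
  rewrite -mulrBl normrM (gtr0_norm (x := _^-1)) ?invr_gt0//.
  rewrite ler_piMl ?invr_ge0 ?(ltW N0)//.
  have [ij|ij] := leqP (t j) (t j.+1).
    rewrite distrC -natrB// ger0_norm// -[1]/(1%:R) ler_nat /t; lia.
  rewrite -natrB 1?ltnW// ger0_norm// -[1]/(1%:R) ler_nat /t; lia.
(* This index lies on the plateau and is congruent to [j] modulo [p]. *)
move=> j; have -> : x j = z (N + `|((j - N%:Z) %% p%:Z)%Z|)%N.
  set r := `|_|%N.
  have rE : r%:Z = ((j - N%:Z) %% p%:Z)%Z by rewrite gez0_abs// modz_ge0// -lt0n.
  have rp : (r < p)%N by rewrite -ltz_nat rE ltz_pmod.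
  rewrite /z /tr; have -> : x (N + r)%N%:Z = x j.
    rewrite PoszD rE.
    have jE := divz_eq (j - N%:Z) p%:Z.
    set q := ((j - N%:Z) %/ p%:Z)%Z in jE.
    set u := (_ %% _)%Z in jE *.
    case: (q) jE => k jE.
      by rewrite -(xpn _ k); congr x; lia.
    by rewrite -(xpn j k.+1); congr x; lia.
  have -> : t (N + r)%N = N by rewrite /t /n; lia.
  by rewrite divff ?gt_eqF// of_real1 scale1r.
apply: (H n z zl).
have : (`|((j - N%:Z) %% p%:Z)%Z| < p)%N.
  by rewrite -ltz_nat gez0_abs ?ltz_pmod// modz_ge0// -lt0n.
by rewrite /n; lia.
Qed.

End loops.

(** * The fixed sequence of the shift and products of weights *)

Section weights.
Variables (R : realType) (F : scalar_kind) (w : int -> scalar_field R F).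
Hypothesis w0 : forall n, w n != 0.
Local Notation K := (scalar_field R F).

(* The formal solution of [B_w v = v] with [v 0 = 1]. *)
Definition fixed_seq (n : int) : K :=
  match n with
  | Posz k => (\prod_(i < k) w (i%:Z + 1))^-1
  | Negz k => \prod_(i < k.+1) w (- i%:Z)
  end.
Local Notation v := fixed_seq.

Lemma fixed_seq_neq0 n : v n != 0.
Proof.
by case: n => n /=; rewrite ?invr_neq0//; apply/prodf_neq0 => i _.
Qed.

Lemma fixed_seqS n : v n = w (n + 1) * v (n + 1).
Proof.
case: n => [n|[|n]].
- have nE : n%:Z + 1 = n.+1%:Z by lia.
  by rewrite nE /= big_ord_recr /= nE invfM mulrCA mulfV ?mulr1.
- have -> : Negz 0 + 1 = 0 by lia.
  by rewrite /= big_ord0 invr1 mulr1 big_ord1 oppr0.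
have -> : Negz n.+1 + 1 = Negz n by lia.
by rewrite {1}/fixed_seq big_ord_recr/= mulrC NegzE.
Qed.

(** Division by [v] turns the weighted shift into the plain one, so a ratio [x n / v n] is carried
    along unchanged; [gain n] converts the modulus of an entry at [n] into the modulus of that
    ratio. *)
Definition gain (n : int) : R := (modulus (v n))^-1.

Lemma modulus_fixed_seq_gt0 n : 0 < modulus (v n).
Proof. exact/modulus_gt0/fixed_seq_neq0. Qed.

Lemma gain_gt0 n : 0 < gain n.
Proof. by rewrite invr_gt0 modulus_fixed_seq_gt0. Qed.

Lemma gain_fixed_seq n : gain n * modulus (v n) = 1.
Proof. by rewrite mulVf// gt_eqF// modulus_fixed_seq_gt0. Qed.

Lemma fixed_seq_prod_up (n : int) (k : nat) :
  \prod_(0 <= j < k) w (n + 1 + j%:Z) = v n / v (n + k%:Z).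
Proof.
elim: k => [|k IH]; first by rewrite big_nil addr0 divff ?fixed_seq_neq0.
rewrite big_nat_recr//= IH; have := fixed_seqS (n + k%:Z).
have -> : n + k%:Z + 1 = n + k.+1%:Z by lia.
have -> : n + 1 + k%:Z = n + k.+1%:Z by lia.
move=> ->.
by rewrite invfM mulrA mulrAC mulfVK.
Qed.

Lemma fixed_seq_prod_down (n : int) (k : nat) :
  \prod_(0 <= j < k) w (n - j%:Z) = v (n - k%:Z) / v n.
Proof.
elim: k => [|k IH]; first by rewrite big_nil subr0 divff ?fixed_seq_neq0.
rewrite big_nat_recr//= IH (fixed_seqS (n - k.+1%:Z)).
have -> : n - k.+1%:Z + 1 = n - k%:Z by lia.
by rewrite mulrC mulrA.
Qed.

End weights.

(** * Powers of the shift, and pseudotrajectories along one ray *)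

Section shift.
Variables (R : realType) (F : scalar_kind) (s : space_kind R).
Local Notation K := (scalar_field R F).
Local Notation X := (seqspace F s).
Variable w : int -> K.
Hypotheses (wb : bounded_weight w) (wi : bounded_below_weight w).
Let B := bshift s wb wi.
Local Notation v := (fixed_seq w).
Local Notation g := (gain w).
Let w0 n : w n != 0 := weight_neq0 wi n.
Let v0 n : v n != 0 := fixed_seq_neq0 w0 n.

Lemma iter_shiftE (x : X) (k : nat) n :
  iter k B x n = v n / v (n + k%:Z) * x (n + k%:Z).
Proof.
elim: k n => [|k IH] n; first by rewrite addr0 divff ?mul1r.
rewrite iterS bshiftE IH (fixed_seqS w0 n) -addrA -PoszD add1n.
by rewrite !mulrA.
Qed.

Lemma iter_shift_invE (x : X) (k : nat) n :
  iter k (iop_inv B) x n = v n / v (n - k%:Z) * x (n - k%:Z).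
Proof.
elim: k n => [|k IH] n; first by rewrite subr0 divff ?mul1r.
rewrite iterS /= /bshift_inv_seq IH (fixed_seqS w0 (n - 1)) subrK.
have -> : n - 1 - k%:Z = n - k.+1%:Z by lia.
by rewrite !mulrA mulVf// mul1r.
Qed.

Lemma opow_shiftE (x : X) (j : int) n :
  opow B j x n = v n / v (n + j) * x (n + j).
Proof. by case: j => k; rewrite ?iter_shiftE// NegzE iter_shift_invE. Qed.

(* [ray m c] follows the coordinate [m] under iteration of [B], the increment at
   time [j] having modulus [`|c j|]. *)
Definition ray_sum (m : int) (c : nat -> R) (j : nat) : R :=
  \sum_(i < j) c i * g (m - 1 - i%:Z).

Definition ray (m : int) (c : nat -> R) (j : nat) : X :=
  delta s (of_real F (ray_sum m c j) * v (m - j%:Z)) (m - j%:Z).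

Lemma ray_coord m c j :
  ray m c j (m - j%:Z) = of_real F (ray_sum m c j) * v (m - j%:Z).
Proof. by rewrite deltaE eqxx. Qed.

Lemma modulus_ray_coord m c j :
  modulus (ray m c j (m - j%:Z)) = `|ray_sum m c j| / g (m - j%:Z).
Proof. by rewrite ray_coord modulusM modulus_of_real /gain invrK. Qed.

Lemma shift_ray m c j :
  B (ray m c j) - ray m c j.+1 =
  delta s (- of_real F (c j * g (m - 1 - j%:Z)) * v (m - j.+1%:Z)) (m - j.+1%:Z).
Proof.
apply: seqspaceP => n; rewrite seqspaceBE bshiftE /ray !deltaE.
have -> : (n + 1 == m - j%:Z) = (n == m - j.+1%:Z) by lia.
case: ifP => [/eqP ->|]; last by rewrite mulr0 subrr.
rewrite /ray_sum big_ord_recr /= of_realD.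
rewrite (fixed_seqS w0 (m - j.+1%:Z)).
have -> : m - j.+1%:Z + 1 = m - j%:Z by lia.
by ring.
Qed.

(** The entry moved by [B] keeps its ratio to [v], so the jump shows only the newest term of
    [ray_sum], whose factor [g] cancels the modulus of [v] at the new position. *)
Lemma rnorm_shift_ray m c j : rnorm (B (ray m c j) - ray m c j.+1) <= `|c j|.
Proof.
rewrite shift_ray (le_trans (rnorm_delta _ _ _))//.
rewrite modulusM modulusN modulus_of_real normrM (gtr0_norm (gain_gt0 w0 _)).
have -> : m - 1 - j%:Z = m - j.+1%:Z by lia.
by rewrite -mulrA gain_fixed_seq// mulr1.
Qed.

Lemma ray_loop d m c n : (forall j, (j < n)%N -> `|c j| < d) ->
  ray_sum m c n = 0 -> loop B d n (ray m c).
Proof.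
move=> cd c0.
have del0 k : delta s 0 k = 0 :> X.
  by apply: seqspaceP => i; rewrite deltaE seqspace0E; case: ifP.
split.
- by rewrite /ray /ray_sum big_ord0 of_real0 mul0r del0.
- by rewrite /ray c0 of_real0 mul0r del0.
by move=> j /cd; apply: le_lt_trans; exact: rnorm_shift_ray.
Qed.

End shift.

(** * Condition (iii) from small loops *)

Lemma modulus_lt_sum (R : realType) (F : scalar_kind) (e d : R)
    (y : scalar_field R F) (z : nat -> scalar_field R F) (p : nat) :
  0 <= e -> 0 <= d ->
  modulus (of_real F e * y - of_real F d * \sum_(i < p) z i) < d ->
  e * modulus y < d * (1 + \sum_(i < p) modulus (z i)).
Proof.
move=> e0 d0 h.
have := modulusB (of_real F e * y) (of_real F d * \sum_(i < p) z i).
rewrite !modulusM !modulus_of_real !ger0_norm// => h'.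
have := ler_wpM2l d0 (modulus_sum p z); lra.
Qed.

Section weight_condition.
Variables (R : realType) (F : scalar_kind) (s : space_kind R).
Local Notation K := (scalar_field R F).
Local Notation X := (seqspace F s).
Variable w : int -> K.
Hypotheses (wb : bounded_weight w) (wi : bounded_below_weight w).
Let B := bshift s wb wi.
Local Notation v := (fixed_seq w).
Local Notation g := (gain w).
Let w0 n : w n != 0 := weight_neq0 wi n.

Lemma small_loops_weight_condition : small_loops B -> weight_condition w.
Proof.
move=> h; apply/forall_exists_of_real => e e0; have [d d0 H] := h e e0.
exists d => // k l m kl lm; apply/orP/contraT; rewrite negb_or => /andP[].
rewrite !normr_modulus !ler_of_real -!ltNge.
set p := `|m - l|%N; set q := `|l - k|%N.
have mE : m = l + p%:Z by rewrite /p; lia.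
have lE : l = k + q%:Z by rewrite /q; lia.
have g0 := gain_gt0 w0.
have aE : \sum_(0 <= i < p) (\prod_(0 <= j < i.+1) w (m - j%:Z))^-1 =
    \sum_(i < p) v m / v (m - i.+1%:Z).
  rewrite big_mkord; apply: eq_bigr => i _.
  by rewrite fixed_seq_prod_down// invfM invrK mulrC.
have up n : \prod_(0 <= j < n) w (k + j%:Z) = v (k - 1) / v (k - 1 + n%:Z).
  by rewrite -fixed_seq_prod_up//; apply: eq_bigr => j _; congr w; lia.
have bE : \sum_(0 <= i < q) \prod_(0 <= j < i.+1) w (k + j%:Z) =
    \sum_(i < q) v (k - 1) / v (k - 1 + i.+1%:Z).
  by rewrite big_mkord; apply: eq_bigr => i _.
rewrite aE bE fixed_seq_prod_up// -mE up invfM invrK (mulrC _^-1).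
have -> : k - 1 + q.+1%:Z = l by lia.
rewrite (mulrC _ (of_real F e)).
(* The triangle inequality removes the phases of the weights; from here on only moduli count. *)
move=> /(modulus_lt_sum (z := fun i => v m / v (m - i.+1%:Z)) (ltW e0) (ltW d0)) ha.
move=> /(modulus_lt_sum (z := fun i => v (k - 1) / v (k - 1 + i.+1%:Z))
  (ltW e0) (ltW d0)); move: ha.
have vV a b : modulus (v a / v b) = modulus (v a) * g b.
  by rewrite modulusM modulusV.
(* After multiplication by [g m] and [g (k - 1)], the failures of (a) and (b) read
   [e * g l < d * S1] and [e * g l < d * S2]. *)
pose S1 := \sum_(i < p.+1) g (m - i%:Z).
pose S2 := \sum_(i < q.+1) g (l - 1 - i%:Z).
have S1E : g m * (1 + \sum_(i < p) modulus (v m / v (m - i.+1%:Z))) = S1.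
  rewrite /S1 big_ord_recl subr0 mulrDr mulr1 mulr_sumr; congr (_ + _).
  by apply: eq_bigr => i _; rewrite vV mulrA gain_fixed_seq// mul1r.
have S2E : g (k - 1) * (1 + \sum_(i < q) modulus (v (k - 1) / v (k - 1 + i.+1%:Z)))
    = S2.
  rewrite /S2 big_ord_recr mulrDr mulr1 mulr_sumr [LHS]addrC.
  congr (_ + _); last by rewrite /=; congr g; lia.
  rewrite (reindex_inj rev_ord_inj); apply: eq_bigr => i _ /=.
  rewrite vV mulrA gain_fixed_seq// mul1r; congr g.
  by have := ltn_ord i; lia.
rewrite (vV m) (vV (k - 1)) -(ltr_pM2l (g0 m)) => ha; rewrite -(ltr_pM2l (g0 (k - 1))); move: ha.
have gK a b c : g a * (b * (modulus (v a) * c)) = b * c.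
  by rewrite mulrA mulrACA gain_fixed_seq// mul1r.
rewrite !gK !(mulrCA _ d) S1E S2E => hS1 hS2.
have S10 : 0 < S1 by rewrite -(pmulr_rgt0 _ d0) (lt_trans _ hS1)// mulr_gt0.
have S20 : 0 < S2 by rewrite -(pmulr_rgt0 _ d0) (lt_trans _ hS2)// mulr_gt0.
(* The ray starts at coordinate [m + 1]. Increments [t1 < d] at the coordinates [m] down to [l]
   raise the coefficient to [e * g l], which is an entry of modulus [e] at [l]; increments [- t2] at
   [l - 1] down to [k - 1] bring it back to [0]. *)
pose t1 := e * g l / S1; pose t2 := e * g l / S2.
pose c i := if (i < p.+1)%N then t1 else - t2.
have c1 : ray_sum w (m + 1) c p.+1 = e * g l.
  transitivity (t1 * S1); last by rewrite /t1 divfK ?gt_eqF.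
  rewrite mulr_sumr; apply: eq_bigr => i _; rewrite /c ltn_ord.
  by congr (_ * g _); lia.
have c2 : ray_sum w (m + 1) c (p.+1 + q.+1) = 0.
  rewrite /ray_sum big_split_ord /= -/(ray_sum w (m + 1) c p.+1) c1.
  transitivity (e * g l - t2 * S2); last by rewrite /t2 divfK ?gt_eqF// subrr.
  congr (_ + _); rewrite -mulNr mulr_sumr; apply: eq_bigr => i _.
  by rewrite /c ltnNge leq_addr /=; congr (_ * g _); lia.
have cd j : (j < p.+1 + q.+1)%N -> `|c j| < d.
  move=> _; rewrite /c; case: ifP => _; rewrite ?normrN ger0_norm.
  - by rewrite ltr_pdivrMr.
  - by rewrite divr_ge0 ?mulr_ge0// ltW.
  - by rewrite ltr_pdivrMr.
  - by rewrite divr_ge0 ?mulr_ge0// ltW.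
have := H _ _ (ray_loop s wb wi cd c2) p.+1 (leq_addr _ _).
rewrite ltNge => /negP; case.
apply: le_trans (modulus_le_rnorm _ (m + 1 - p.+1%:Z)).
rewrite modulus_ray_coord// c1.
have -> : m + 1 - p.+1%:Z = l by lia.
by rewrite gtr0_norm ?mulr_gt0// mulfK ?gt_eqF.
Qed.

End weight_condition.

(** * Tails and domination in the sequence space *)

Lemma finite_set_window (A : set int) : finite_set A ->
  exists N : nat, forall n, A n -> (`|n| < N)%N.
Proof.
move=> /finite_fsetP[B AB].
exists (\max_(n <- finmap.enum_fset B) `|n|%N).+1 => n; rewrite AB /= => nB.
by rewrite ltnS; apply: (leq_bigmax_seq (F := fun n : int => `|n|%N)).
Qed.

Section approximation.
Variables (R : realType) (F : scalar_kind) (s : space_kind R).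
Local Notation K := (scalar_field R F).
Local Notation X := (seqspace F s).

(** The translation may depend on [n] but takes at most [q] values: [y] splits into [q] pieces, each
    dominated by one fixed translate of [a]. *)
Lemma seqspace_dom_choice (y : int -> K) (C : R) (q : nat) (r : int -> nat)
    (a : X) : 0 <= C -> (forall n, (r n < q)%N) ->
  (forall n, modulus (y n) <= C * modulus (a (n + (r n)%:Z))) ->
  in_seqspace s y.
Proof.
move=> C0 rq ya.
have /choice[z zE] (i : nat) :
    exists z : X, forall n, z n = if r n == i then y n else 0.
  have [|z zE _] := @seqspace_dom _ _ _
    (fun n => if r n == i then y n else 0) C i%:Z a C0; last by exists z.
  move=> n /=; case: eqP => [<-//|_].
  by rewrite modulus0 mulr_ge0 ?modulus_ge0.
have -> : y = \sum_(i < q) z i; last exact: seqspace_in.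
apply/funext => n; rewrite seqspace_sumE (bigD1 (Ordinal (rq n)))//= zE eqxx.
rewrite big1 ?addr0// => i /eqP ri; rewrite zE; case: eqP => // rni.
by exfalso; apply: ri; apply: val_inj.
Qed.

(** For $\ell_p$, some finite set carries all of [psum p x] but less than [e] to the power [p], and
    a dominated sequence vanishing there fits into the remainder. For $c_0$, the bound [e / 2] on
    the far entries keeps the supremum strictly below [e]. *)
Lemma seqnorm_tail (x : int -> K) (e : R) : in_seqspace s x -> 0 < e ->
  exists N : nat, forall y : int -> K, in_seqspace s y ->
    (forall n : int, (`|n| < N)%N -> y n = 0) ->
    (forall n, modulus (y n) <= modulus (x n)) -> seqnorm s y < e.
Proof.
case: s => [p p1|] xs e0.
  have p0 : 0 < p by rewrite (lt_le_trans _ p1).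
  have ep : 0 < e `^ p by rewrite powR_gt0.
  have xfin : psum p x \is a fin_num by rewrite (psum_fin xs).
  have [_ [A [finA _] <-] hA] := ub_ereal_sup_adherent ep xfin.
  have [N NA] := finite_set_window finA.
  exists N => y ys y0 yx /=.
  have yfin : psum p y \is a fin_num by rewrite (psum_fin ys).
  have hy : (psum p y + \sum_(i \in A) (modulus (x i) `^ p)%:E <= psum p x)%E.
    rewrite -esum_fset//; last by move=> i _; rewrite lee_fin powR_ge0.
    rewrite esum_mkcond /psum -esumD; first last.
    - by move=> i _; case: ifP => _ //; rewrite lee_fin powR_ge0.
    - by move=> i _; rewrite lee_fin powR_ge0.
    apply: le_esum => i _; case: ifPn => [/set_mem Ai|_].
      by rewrite y0 ?NA// modulus0 powR0 ?gt_eqF// add0e.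
    rewrite adde0 lee_fin ge0_ler_powR ?nnegrE ?modulus_ge0//; exact: ltW.
  have : (psum p y < (e `^ p)%:E)%E.
    have : (psum p x - (e `^ p)%:E < psum p x - psum p y)%E.
      by apply: lt_le_trans hA _; rewrite leeBrDr// addeC.
    move: xfin yfin; move: (psum p x) (psum p y) => [a| |]// [b| |]// _ _.
    by rewrite -!EFinB !lte_fin ltrD2l ltrN2.
  rewrite -[X in (X < _)%E -> _](fineK yfin) lte_fin => h.
  rewrite -[ltRHS](powRr1 (ltW e0)) -(mulfV (lt0r_neq0 p0)) powRrM.
  by rewrite gt0_ltr_powR ?invr_gt0 ?nnegrE ?powR_ge0 ?fine_ge0 ?psum_ge0.
have e20 : 0 < e / 2 by rewrite divr_gt0.
have [N xN] := xs _ e20; exists N => y ys y0 yx.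
rewrite (@le_lt_trans _ _ (e / 2))//; last first.
  by rewrite ltr_pdivrMr// ltr_pMr// ltr1n.
apply: ge_sup; first by exists (modulus (y 0)), 0.
move=> _ [n _ <-]; have [nN|Nn] := ltnP `|n|%N N.
  by rewrite y0// modulus0 ltW.
by rewrite (le_trans (yx n))// ltW// xN.
Qed.

Lemma seqspace_tail (x : X) (e : R) : 0 < e -> exists N : nat, forall y : X,
  (forall n : int, (`|n| < N)%N -> y n = 0) ->
  (forall n, modulus (y n) <= modulus (x n)) -> rnorm y < e.
Proof.
move=> e0; have [N xN] := seqnorm_tail (seqspace_in x) e0.
by exists N => y; apply: xN; exact: seqspace_in.
Qed.

Lemma bounded_on_window (f : int -> R) (N : nat) :
  exists2 H : R, 0 <= H & forall n : int, (`|n| < N)%N -> f n <= H.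
Proof.
elim: N => [|N [H H0 fH]]; first by exists 0.
exists (H + `|f N%:Z| + `|f (- N%:Z)|) => [|n]; first by rewrite !addr_ge0.
rewrite ltnS leq_eqVlt => /predU1P[nN|nN]; last first.
  by rewrite -addrA (le_trans (fH n nN))// lerDl addr_ge0.
have [->|->] : n = N%:Z \/ n = - N%:Z by lia.
  by rewrite -addrA (le_trans (ler_norm _))// addrCA lerDl addr_ge0.
by rewrite (le_trans (ler_norm _))// lerDr addr_ge0.
Qed.

End approximation.

(** * Periodic points: trivial or dense *)

Section periodic_points.
Variables (R : realType) (F : scalar_kind) (s : space_kind R).
Local Notation K := (scalar_field R F).
Local Notation X := (seqspace F s).
Variable w : int -> K.
Hypotheses (wb : bounded_weight w) (wi : bounded_below_weight w).
Let B := bshift s wb wi.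
Local Notation v := (fixed_seq w).
Let w0 n : w n != 0 := weight_neq0 wi n.
Let v0 n : v n != 0 := fixed_seq_neq0 w0 n.

Lemma fixed_seq_growth : exists2 M : R, 1 <= M &
  forall n (k : nat), modulus (v n) <= M ^+ k * modulus (v (n + k%:Z)).
Proof.
case: wb => M wM; exists (Num.max 1 M); first by rewrite le_max lexx.
have wM' n : modulus (w n) <= Num.max 1 M.
  by rewrite le_max wM ?orbT//; exists n.
move=> n; elim=> [|k IH]; first by rewrite addr0 mul1r.
rewrite (le_trans IH)// exprSr -mulrA ler_wpM2l ?exprn_ge0 ?le_max ?ler01//.
rewrite (fixed_seqS w0 (n + k%:Z)) modulusM.
have -> : n + k%:Z + 1 = n + k.+1%:Z by lia.
by rewrite ler_wpM2r ?modulus_ge0.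
Qed.

Lemma seq_periodicZ (T : Type) (h : int -> T) (q : nat) :
  (forall n, h (n + q%:Z) = h n) -> forall n k, h (n + k * q%:Z) = h n.
Proof.
move=> hq; have pos n (k : nat) : h (n + k%:Z * q%:Z) = h n.
  elim: k => [|k IH]; first by rewrite mul0r addr0.
  by rewrite -addn1 PoszD mulrDl mul1r addrA hq.
move=> n [] k; first exact: pos.
by rewrite -(pos _ k.+1) NegzE mulNr subrK.
Qed.

(** If [B] to the power [q] fixes a nonzero [a], then [a / v] is [q]-periodic and takes one nonzero
    value on the whole class of [i0] modulo [q]. Fewer than [q] steps after any [n] lies an index of
    this class, where [v] is a fixed multiple of [a]; bounded weights carry the estimate back to
    [n], which puts [v] in the space. *)
Lemma per_shift_trivial : ~ in_seqspace s v -> Per B = [set 0].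
Proof.
move=> vX; apply/seteqP; split=> [a [q q0 aq]|_ ->]; last first.
  by exists 1%N => //=; rewrite raddf0.
apply: contrapT => /= a0; apply: vX.
have [i0 ai0] : exists i, a i != 0.
  apply: contrapT => h; apply: a0; apply: seqspaceP => n; rewrite seqspace0E.
  by apply/eqP/negPn/negP => an; apply: h; exists n.
pose h n := a n / v n.
have hq n : h (n + q%:Z) = h n.
  rewrite /h -[in RHS]aq iter_shiftE//.
  by rewrite [RHS]mulrAC [v n / _]mulrC mulfK// [RHS]mulrC.
pose r n := `|((i0 - n) %% q%:Z)%Z|%N.
have rE n : h (n + (r n)%:Z) = h i0.
  have q0' : q%:Z != 0 by rewrite -lt0n.
  rewrite /r gez0_abs ?modz_ge0// -[LHS](seq_periodicZ hq _ ((i0 - n) %/ q%:Z)%Z).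
  by congr h; have := divz_eq (i0 - n) q%:Z; set u := (_ * _); lia.
have h0 : 0 < modulus (h i0) by rewrite modulus_gt0 ?mulf_neq0 ?invr_neq0.
have [M M1 vM] := fixed_seq_growth.
have M0 : 0 <= M by rewrite (le_trans ler01).
have rq n : (r n < q)%N.
  by rewrite -ltz_nat gez0_abs ?ltz_pmod ?modz_ge0// -lt0n.
apply: (@seqspace_dom_choice _ _ _ v (M ^+ q / modulus (h i0)) q r a) => //.
  by rewrite divr_ge0 ?exprn_ge0 ?(ltW h0).
move=> n; rewrite (le_trans (vM n (r n)))// -mulrA ler_pM ?exprn_ge0 ?modulus_ge0//.
  by rewrite ler_weXn2l// ltnW.
rewrite -(rE n) /h modulusM modulusV invfM invrK mulrAC mulVf ?mul1r//.
by rewrite gt_eqF// modulus_gt0//; move: h0; rewrite -(rE n) /h; case: eqP => // ->; rewrite mul0r modulus0 ltxx.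
Qed.

(** The ratio [x / v], cut to a window and repeated periodically, gives a periodic point after
    multiplication by [v]. The repeated copies are at most [H] times [v] and sit far out, where [v]
    has a small tail. *)
Lemma per_shift_dense : in_seqspace s v -> dense (Per B).
Proof.
move=> vs; pose V : X := SeqSpace (introT (in_seqspaceP s _) vs).
move=> O [x Ox] oO.
have /nbhs_ballP[_/posnumP[e'] eO] : nbhs x O by exact: open_nbhs_nbhs.
have [e e0 e'E] := gt0_of_real (gt0 e').
suff [a Ba xa] : exists2 a : X, periodic_point B a & rnorm (x - a) < e.
  exists a; split => //; apply: eO.
  by rewrite -ball_normE /ball_/= e'E rnorm_lt.
have e20 : 0 < e / 2 by rewrite divr_gt0.
have [N xN] := seqspace_tail x e20.
have [H H0 hH] := bounded_on_window (fun n => modulus (x n / v n)) N.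
have [N' vN] := seqspace_tail (of_real F H *: V) e20.
pose Q := (maxn N N').+1; pose q := (Q + Q)%N.
(* The representative modulo [q] between [- Q] and [Q - 1]; the window is left in place. *)
pose rep (i : int) := ((i + Q%:Z) %% q%:Z)%Z - Q%:Z.
have repE i : (`|i| < Q)%N -> rep i = i.
  by move=> iQ; rewrite /rep modz_small ?addrK// /q; lia.
have repq i : rep (i + q%:Z) = rep i.
  by rewrite /rep (addrAC i) modzDr.
pose h0 n := if (`|n| < N)%N then x n / v n else 0.
have h0H n : modulus (h0 n) <= H.
  by rewrite /h0; case: ifP => [/hH//|_]; rewrite modulus0.
have [a aE _] : exists2 a : X, (forall n, a n = v n * h0 (rep n)) &
    rnorm a <= H * rnorm V.
  apply: (@seqspace_dom _ _ s (fun n => v n * h0 (rep n)) H 0) => // n.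
  by rewrite addr0 modulusM mulrC ler_wpM2r ?modulus_ge0.
have [b bE _] : exists2 b : X, (forall n, b n = if (`|n| < N)%N then x n else 0) &
    rnorm b <= 1 * rnorm x.
  apply: (@seqspace_dom _ _ s _ 1 0) => // n; rewrite addr0 mul1r.
  by case: ifP => // _; rewrite modulus0 modulus_ge0.
exists a.
  exists q; first by rewrite /q.
  apply: seqspaceP => n; rewrite iter_shiftE// !aE repq mulrA divfK//.
(* [b] is the truncation of [x] to the window: [x - b] is a tail of [x], and [a - b] consists of the
   far copies. *)
have -> : x - a = (x - b) - (a - b) by rewrite opprB addrA subrK.
rewrite (le_lt_trans (rnormB _ _))// [e]splitr ltrD//.
  apply: xN => n; rewrite seqspaceBE bE.
    by move=> ->; rewrite subrr.
  by case: ifP => _; rewrite ?subr0// subrr modulus0 modulus_ge0.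
apply: vN => n; rewrite seqspaceBE bE aE.
  move=> nN; rewrite repE; last by rewrite ltnS leq_max (ltnW nN) orbT.
  rewrite /h0; case: ifP => _; last by rewrite mulr0 subr0.
  by rewrite mulrCA mulfV// mulr1 subrr.
rewrite seqspaceZE modulusM modulus_of_real ger0_norm// mulrC.
have [nQ|nQ] := ltnP `|n|%N Q.
  rewrite repE// /h0; case: ifP => _.
    by rewrite divfK// subrr modulus0 mulr_ge0 ?modulus_ge0.
  by rewrite mul0r subr0 modulus0 mulr_ge0 ?modulus_ge0.
rewrite ifF ?subr0; first by rewrite modulusM ler_wpM2r ?modulus_ge0.
by apply/negbTE; rewrite -leqNgt (leq_trans _ nQ)// leqW// leq_maxl.
Qed.

End periodic_points.

(** * Decay, geometric estimates and orbits *)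

Lemma seqspace_vanish (R : realType) (F : scalar_kind) (s : space_kind R)
    (x : seqspace F s) (e : R) : 0 < e ->
  exists N : nat, forall n : int, (N <= `|n|)%N -> modulus (x n) < e.
Proof.
move=> e0; have [N xN] := seqspace_tail x e0; exists N => n Nn.
have : rnorm (delta s (x n) n) < e.
  apply: xN => [i iN|i]; rewrite deltaE; case: eqP => [iE|_] //.
  - by move: iN; rewrite iE ltnNge Nn.
  - by rewrite iE.
  - by rewrite modulus0 modulus_ge0.
by apply: le_lt_trans; have := modulus_le_rnorm (delta s (x n) n) n; rewrite deltaE eqxx.
Qed.

Lemma geometric_sum_le (R : realType) (r : R) (n : nat) : 0 <= r < 1 ->
  \sum_(k < n) r ^+ k <= (1 - r)^-1.
Proof.
move=> /andP[r0 r1]; have r1' : 0 < 1 - r by rewrite subr_gt0.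
rewrite -[leRHS]mul1r ler_pdivlMr// mulrC -opprB mulNr -subrX1 opprB.
by rewrite gerBl exprn_ge0.
Qed.

Lemma geometric_lt (R : realType) (r A e : R) : 0 <= r < 1 -> 0 < e ->
  exists N : nat, A * r ^+ N < e.
Proof.
move=> /andP[r0 r1] e0.
have rc : (fun n => r ^+ n) @ \oo --> (0 : R) by apply: cvg_expr; rewrite ger0_norm.
have A1 : 0 < `|A| + 1 by rewrite ltr_wpDl.
have /cvgrPdist_lt/(_ _ (divr_gt0 e0 A1)) [N _ /(_ N (leqnn _))/=] := rc.
rewrite sub0r normrN ltr_pdivlMr// (ger0_norm (exprn_ge0 _ r0)) => h.
exists N; apply: le_lt_trans h; rewrite mulrC ler_wpM2l ?exprn_ge0//.
by rewrite (le_trans (ler_norm _))// lerDl.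
Qed.

(** A discrete Gronwall argument: the hypothesis makes each partial sum at least [1 + C^-1] times
    the preceding one, and it also bounds the last partial sum by [C] times the next term. *)
Lemma exponential_growth (R : realType) (f : nat -> R) (C : R) : 0 < C ->
  (forall i, 0 <= f i) -> (forall b, \sum_(i < b) f i <= C * f b) ->
  forall i k, f i <= (C + 1) * ((1 + C^-1)^-1) ^+ k * f (i + k)%N.
Proof.
move=> C0 f0 fC i [|k].
  by rewrite addn0 mulr1 ler_peMl// lerDr ltW.
pose S b := \sum_(j < b) f j; pose r := 1 + C^-1.
have r0 : 0 < r by rewrite addr_gt0// invr_gt0.
have Sr b : r * S b <= S b.+1.
  rewrite /S big_ord_recr /= mulrDl mul1r lerD2l mulrC ler_pdivrMr// mulrC.
  exact: fC.
have Srk b : r ^+ b * S i.+1 <= S (i.+1 + b)%N.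
  elim: b => [|b IH]; first by rewrite addn0 mul1r.
  by rewrite addnS (le_trans _ (Sr _))// exprS -mulrA ler_wpM2l// ltW.
have fS : f i <= S i.+1 by rewrite /S big_ord_recr /= lerDr sumr_ge0.
have h : r ^+ k * f i <= C * f (i + k.+1)%N.
  rewrite addnS -addSn (le_trans _ (fC _))// (le_trans _ (Srk k))//.
  by rewrite ler_wpM2l// exprn_ge0// ltW.
(* The induction gains [k] powers of [r] over [k + 1] steps; the missing one is absorbed in the
   constant. *)
have -> : C + 1 = C * r by rewrite mulrDr mulr1 mulfV ?gt_eqF.
rewrite exprVn exprS invfM mulrA -(mulrA C) mulfV ?gt_eqF// mulr1 mulrAC.
by rewrite ler_pdivlMr ?exprn_gt0// mulrC.
Qed.

Lemma opow_orbit (K : numFieldType) (X : normedModType K)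
    (T : invertible_operator X) (y : int -> X) :
  (forall j, y (j + 1) = T (y j)) -> forall j, y j = opow T j (y 0).
Proof.
move=> yT [] n /=.
  by elim: n => [|n IH] //; rewrite -addn1 PoszD yT IH addn1.
have yV j : iop_inv T (y j) = y (j - 1).
  by rewrite -[in LHS](subrK 1 j) yT iopK.
elim: n => [|n IH]; first by rewrite yV.
by rewrite iterS -IH yV; congr y; lia.
Qed.

(** * Limits and series in the sequence space *)

Section series.
Variables (R : realType) (F : scalar_kind) (s : space_kind R).
Local Notation K := (scalar_field R F).
Local Notation X := (seqspace F s).

(** For $\ell_p$, a finite part of the sum for [u] coincides with that of some [U N], hence obeys
    the same bound. For $c_0$, uniform closeness to some [U N] gives decay at infinity. *)
Lemma in_seqspace_limit (U : nat -> int -> K) (u : int -> K) (S : R) :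
  (forall N, in_seqspace s (U N)) -> (forall N, seqnorm s (U N) <= S) ->
  (forall (n : int) N, (`|n| < N)%N -> u n = U N n) ->
  (forall e, 0 < e -> exists N, forall n, modulus (u n - U N n) < e) ->
  in_seqspace s u /\ seqnorm s u <= S.
Proof.
case: s => [p p1|] Us US uU ulim; last first.
  split; last first.
    apply: ge_sup; first by exists (modulus (u 0)), 0.
    move=> _ [n _ <-]; rewrite (uU n `|n|.+1)// (le_trans _ (US `|n|.+1))//.
    exact: modulus_le_seqnorm.
  move=> e e0; have e20 : 0 < e / 2 by rewrite divr_gt0.
  have [N uN] := ulim _ e20; have [M UM] := Us N _ e20.
  exists M => n Mn; rewrite -[u n](subrK (U N n)) (le_lt_trans (modulusD _ _))//.
  by rewrite [e]splitr ltrD// UM.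
have p0 : 0 < p by rewrite (lt_le_trans _ p1).
have S0 : 0 <= S by rewrite (le_trans _ (US 0%N))// seqnorm_ge0.
have le : (psum p u <= (S `^ p)%:E)%E.
  apply: esum_ler => A finA.
  have [N NA] := finite_set_window finA.
  have -> : (\sum_(i \in A) (modulus (u i) `^ p)%:E =
      \sum_(i \in A) (modulus (U N i) `^ p)%:E)%E.
    by apply: eq_fsbigr => i /set_mem/NA iN; rewrite (uU _ _ iN).
  apply: (@le_trans _ _ (psum p (U N))).
    by apply: ereal_sup_ubound; exists A.
  rewrite (psum_fin (Us N)) lee_fin -(fine_psum p1).
  by rewrite ge0_ler_powR ?nnegrE ?seqnorm_ge0 ?US// ltW.
have us : (psum p u < +oo)%E by rewrite (le_lt_trans le)// ltry.
split=> //; move: le; rewrite [X in (X <= _)%E -> _](psum_fin us) lee_fin => le.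
rewrite /= -[leRHS](powRr1 S0) -(mulfV (lt0r_neq0 p0)) powRrM.
by rewrite ge0_ler_powR ?invr_ge0 ?nnegrE ?powR_ge0 ?fine_ge0 ?psum_ge0// ltW.
Qed.

(* Completeness, for series all of whose coordinates are finite sums. *)
Lemma seqspace_series (y : nat -> X) (A r : R) (u : int -> K) :
  0 <= A -> 0 <= r < 1 -> (forall k, rnorm (y k) <= A * r ^+ k) ->
  (forall (n : int) N, (`|n| < N)%N -> u n = \sum_(k < N) y k n) ->
  exists2 z : X, (forall n, z n = u n) & rnorm z <= A / (1 - r).
Proof.
move=> A0 r01 yA uE; have /andP[r0 r1] := r01.
have r1' : 0 < 1 - r by rewrite subr_gt0.
have tail N M : rnorm (\sum_(k < M) y (N + k)%N) <= A / (1 - r) * r ^+ N.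
  rewrite (le_trans (rnorm_sum (fun k => y (N + k)%N) _))//.
  rewrite (@le_trans _ _ (\sum_(k < M) A * r ^+ N * r ^+ k))//.
    by apply: ler_sum => k _; rewrite -mulrA -exprD yA.
  rewrite -mulr_sumr [leRHS]mulrAC ler_wpM2l ?mulr_ge0 ?exprn_ge0//.
  exact: geometric_sum_le.
have uN (n : int) (N : nat) : (`|n| < N)%N -> u n = (\sum_(k < N) y k) n.
  by move=> nN; rewrite (uE _ _ nN) seqspace_sumE.
suff [us un] : in_seqspace s u /\ seqnorm s u <= A / (1 - r).
  by exists (SeqSpace (introT (in_seqspaceP s _) us)).
apply: (@in_seqspace_limit (fun N => \sum_(k < N) y k)) => //.
- by move=> N; exact: seqspace_in.
- by move=> N; have := tail 0%N N; rewrite expr0 mulr1.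
(* At each coordinate the remainder after [N] terms is a finite sum, so the tail bound holds
   uniformly in [n]. *)
move=> e /(geometric_lt (A / (1 - r)) r01)[N hN]; exists N => n.
rewrite (le_lt_trans _ hN)// (le_trans _ (tail N `|n|.+1))//.
rewrite (uN n (N + `|n|.+1)%N); last by rewrite addnS ltnS leq_addl.
rewrite -seqspaceBE big_split_ord /= addrAC subrr add0r.
exact: modulus_le_rnorm.
Qed.

End series.

(** * From shadowing to the exponential dichotomy *)

Section dichotomy.
Variables (R : realType) (F : scalar_kind) (s : space_kind R).
Local Notation K := (scalar_field R F).
Local Notation X := (seqspace F s).
Variable w : int -> K.
Hypotheses (wb : bounded_weight w) (wi : bounded_below_weight w).
Let B := bshift s wb wi.
Local Notation v := (fixed_seq w).
Local Notation g := (gain w).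
Let w0 n : w n != 0 := weight_neq0 wi n.

(* [B] contracts the coordinates of index [<= 0] and [B^-1] those of index [>= 0] *)
Definition exponential_dichotomy := exists D r : R,
  [/\ 0 <= D, 0 <= r < 1 & forall i k : nat,
    modulus (v (- i%:Z - k%:Z)) <= D * r ^+ k * modulus (v (- i%:Z)) /\
    modulus (v (i%:Z + k%:Z)) <= D * r ^+ k * modulus (v i%:Z)].

(** A common consequence of shadowing and periodic shadowing, from which the dichotomy follows when
    [v] lies in the space. *)
Definition weak_periodic_shadowing := exists2 d : R, 0 < d &
  forall x : int -> X, (forall j, rnorm (B (x j) - x (j + 1)) < d) ->
    periodic_seq x -> exists a : X, forall j, rnorm (x j - opow B j a) < 1.

Lemma shadowing_weak : shadowing B -> weak_periodic_shadowing.
Proof.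
move=> /shadowing_rnorm/(_ 1 ltr01)[d d0 H].
by exists d => // x xd _; exact: H.
Qed.

Lemma periodic_shadowing_weak : periodic_shadowing B -> weak_periodic_shadowing.
Proof.
move=> /periodic_shadowing_rnorm/(_ 1 ltr01)[d d0 H].
by exists d => // x xd xp; have [a _ ax] := H x xd xp; exists a.
Qed.

(** Along a ray starting at [b], an orbit has the constant ratio [a b / v b] to [v]. Shadowing puts
    this constant within [g b] of the initial coefficient [0] and within [g (b - L)] of the
    coefficient at time [L], which is [d / 2] times the sum of gains. *)
Lemma gain_sum_le : in_seqspace s v -> weak_periodic_shadowing ->
  exists2 C : R, 0 < C & forall (b : int) (L : nat),
    \sum_(i < L) g (b - 1 - i%:Z) <= C * (g (b - L%:Z) + g b).
Proof.
move=> vs [d d0 H]; pose V : X := SeqSpace (introT (in_seqspaceP s _) vs).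
have t0 : 0 < d / 2 by rewrite divr_gt0.
have td : d / 2 < d by rewrite ltr_pdivrMr// ltr_pMr// ltr1n.
exists (d / 2)^-1; first by rewrite invr_gt0.
move=> b L; have g0 := gain_gt0 w0.
set S := \sum_(i < L) _.
have S0 : 0 <= S by apply: sumr_ge0 => i _; rewrite ltW.
have [N vN] := seqspace_vanish V (divr_gt0 (@ltr01 R) (ltr_wpDl S0 (@ltr01 R))).
pose n := (L + N + `|b|)%N.
have vn : modulus (v (b - 1 - n%:Z)) * (S + 1) < 1.
  by rewrite -ltr_pdivlMr ?ltr_wpDl//; apply: vN; rewrite /n; lia.
(* Increments [d / 2] for [L] steps, rest until time [n], then one increment cancelling everything;
   the last is below [d] because [v] is small at [b - 1 - n]. *)
pose c i := if (i < L)%N then d / 2 else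
  if (i < n)%N then 0 else - (d / 2 * S / g (b - 1 - n%:Z)).
have cL : ray_sum w b c L = d / 2 * S.
  by rewrite mulr_sumr; apply: eq_bigr => i _; rewrite /c ltn_ord.
have cn : ray_sum w b c n.+1 = 0.
  rewrite /ray_sum big_ord_recr /= {2}/c ltnn ifF; last by rewrite /n; lia.
  rewrite mulNr divfK ?gt_eqF//; apply/eqP; rewrite subr_eq0 -cL; apply/eqP.
  rewrite /n -addnA big_split_ord /= -/(ray_sum w b c L) [X in _ + X]big1 ?addr0//.
  move=> i _; rewrite /c ifF ?ifT ?mul0r//; have := ltn_ord i; lia.
have cd j : (j < n.+1)%N -> `|c j| < d.
  rewrite ltnS => jn; rewrite /c; case: ifP => _; first by rewrite ger0_norm// ltW.
  case: ltnP => [_|nj]; first by rewrite normr0.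
  rewrite normrN ger0_norm ?divr_ge0 ?mulr_ge0// ?ltW//.
  rewrite /gain invrK -mulrA (le_lt_trans _ td)// ler_piMr ?(ltW t0)//.
  rewrite (le_trans _ (ltW vn))// mulrC ler_wpM2l ?modulus_ge0//.
  by rewrite lerDl.
have [x [xd xp xz]] := loop_pseudotrajectory d0 (ray_loop s wb wi cd cn).
have [a ax] := H x xd xp.
have a1 (j : nat) : (j <= n)%N ->
    modulus (of_real F (ray_sum w b c j) - a b / v b) < g (b - j%:Z).
  move=> jn; rewrite /gain -[ltRHS]mul1r ltr_pdivlMr ?modulus_fixed_seq_gt0//.
  rewrite -modulusM.
  have := le_lt_trans (modulus_le_rnorm _ (b - j%:Z)) (ax j%:Z).
  rewrite seqspaceBE xz// ray_coord opow_shiftE// subrK mulrBl.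
  by rewrite [X in _ - X]mulrAC [X in X / _]mulrC mulrAC.
rewrite ler_pdivlMl//.
have := a1 L; have := a1 0%N isT.
rewrite cL /ray_sum big_ord0 of_real0 subr0 /n -addnA leq_addr => h1 /(_ isT) h2.
have -> : d / 2 * S = modulus (of_real F (d / 2 * S)).
  by rewrite modulus_of_real ger0_norm// mulr_ge0// ltW.
rewrite -[of_real F _](subrK (a b / v b)) (le_trans (modulusD _ _))// lerD ?(ltW h2)//.
by move: h1; rewrite sub0r modulusN => /ltW.
Qed.

(** Since [v] is bounded, [g 0] is at most a constant times any [g n]. For blocks with one end at
    [0] the hypothesis thus bounds the sum by the gain at the far end alone, which forces
    exponential growth of [g] on both sides. *)
Lemma exponential_dichotomy_gain : in_seqspace s v -> (exists2 C : R, 0 < C &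
    forall (b : int) (L : nat),
      \sum_(i < L) g (b - 1 - i%:Z) <= C * (g (b - L%:Z) + g b)) ->
  exponential_dichotomy.
Proof.
move=> vs [C C0 gC]; pose V : X := SeqSpace (introT (in_seqspaceP s _) vs).
have g0 n : 0 < g n by exact: gain_gt0.
have gg0 n : 0 <= g n by rewrite ltW.
pose A := g 0 * rnorm V.
have A0 : 0 <= A by rewrite mulr_ge0// rnorm_ge0.
have gA n : g 0 <= A * g n.
  rewrite /A -mulrA ler_peMr//.
  by rewrite -(gain_fixed_seq w0 n) mulrC ler_wpM2r// (modulus_le_rnorm V).
(* On the left the block given by the hypothesis stops at [-1]; adding the summand [g 0] turns [C]
   into [C + 1]. *)
pose D := C + (C + 1) * A.
have D0 : 0 < D by rewrite ltr_pwDl// mulr_ge0// addr_ge0// ltW.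
have right n : \sum_(i < n) g i%:Z <= D * g n%:Z.
  have := gC n%:Z n; rewrite subrr => h.
  have -> : \sum_(i < n) g i%:Z = \sum_(i < n) g (n%:Z - 1 - i%:Z).
    rewrite (reindex_inj rev_ord_inj); apply: eq_bigr => i _ /=.
    by congr g; have := ltn_ord i; lia.
  rewrite (le_trans h)// mulrDr mulrDl addrC lerD2l.
  rewrite -mulrA (le_trans (ler_wpM2l (ltW C0) (gA n%:Z)))//.
  by rewrite ler_wpM2r ?lerDl// mulr_ge0.
have left n : \sum_(i < n) g (- i%:Z) <= D * g (- n%:Z).
  have := gC 0 n; rewrite (sub0r n%:Z) => h.
  have : \sum_(i < n.+1) g (- i%:Z) <= g 0 + C * (g (- n%:Z) + g 0).
    rewrite big_ord_recl oppr0 lerD2l (le_trans _ h)//.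
    rewrite le_eqVlt; apply/orP; left; apply/eqP.
    by apply: eq_bigr => i _; congr g; rewrite /= /bump /=; lia.
  rewrite big_ord_recr /= => h'.
  have := gA (- n%:Z); have := gg0 (- n%:Z); rewrite /D.
  move: (\sum_(i < n) _) (g (- n%:Z)) h' => a b h' b0 g0A.
  have : (C + 1) * g 0 <= (C + 1) * (A * b) by rewrite ler_wpM2l// addr_ge0// ltW.
  by move: h'; nra.
exists (D + 1), ((1 + D^-1)^-1); split.
- by rewrite addr_ge0// ltW.
- by rewrite invr_ge0 addr_ge0 ?invr_ge0 ?(ltW D0)//= invf_lt1 ?ltrDl ?invr_gt0// addr_gt0 ?invr_gt0.
have inv a b (M : R) : g a <= M * g b -> modulus (v b) <= M * modulus (v a).
  rewrite /gain ler_pdivlMr ?modulus_fixed_seq_gt0// mulrC.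
  by rewrite ler_pdivrMr ?modulus_fixed_seq_gt0.
move=> i k; split; apply: inv.
- have -> : - i%:Z - k%:Z = - (i + k)%N%:Z by lia.
  exact: (exponential_growth (f := fun i => g (- i%:Z)) D0).
- exact: (exponential_growth (f := fun i => g i%:Z) D0).
Qed.

End dichotomy.

(** * From the dichotomy to shadowing by a Green function *)

Section shadowing.
Variables (R : realType) (F : scalar_kind) (s : space_kind R).
Local Notation K := (scalar_field R F).
Local Notation X := (seqspace F s).
Variable w : int -> K.
Hypotheses (wb : bounded_weight w) (wi : bounded_below_weight w).
Let B := bshift s wb wi.
Local Notation v := (fixed_seq w).
Let w0 n : w n != 0 := weight_neq0 wi n.
Let v0 n : v n != 0 := fixed_seq_neq0 w0 n.

(* [B^k] after truncation to the negative coordinates, and [B^-k] after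
   truncation to the nonnegative ones *)
Definition past (k : nat) (x : X) (n : int) : K :=
  if n + k%:Z < 0 then v n / v (n + k%:Z) * x (n + k%:Z) else 0.
Definition future (k : nat) (x : X) (n : int) : K :=
  if n - k%:Z < 0 then 0 else v n / v (n - k%:Z) * x (n - k%:Z).

Lemma pastS k x n : w (n + 1) * past k x (n + 1) = past k.+1 x n.
Proof.
rewrite /past; have -> : n + 1 + k%:Z = n + k.+1%:Z by lia.
by case: ifP => _; rewrite ?mulr0// (fixed_seqS w0 n) !mulrA.
Qed.

Lemma futureS k x n : w (n + 1) * future k.+1 x (n + 1) = future k x n.
Proof.
rewrite /future; have -> : n + 1 - k.+1%:Z = n - k%:Z by lia.
by case: ifP => _; rewrite ?mulr0// (fixed_seqS w0 n) !mulrA.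
Qed.

Lemma past0D_future0 x n : past 0 x n + future 0 x n = x n.
Proof.
rewrite /past /future addr0 ?subr0; case: ifP => _; rewrite ?addr0 ?add0r;
by rewrite divff// mul1r.
Qed.

(** With [future_eq0], this reduces the Green function at each coordinate to a finite sum. *)
Lemma past_eq0 k x (n : int) : (`|n| <= k)%N -> past k x n = 0.
Proof. by move=> nk; rewrite /past ifF//; lia. Qed.

Lemma future_eq0 k x (n : int) : (`|n| < k)%N -> future k x n = 0.
Proof. by move=> nk; rewrite /future ifT//; lia. Qed.

Variables (D r : R).
Hypotheses (D0 : 0 <= D) (r01 : 0 <= r < 1).
Hypothesis dich : forall i k : nat,
  modulus (v (- i%:Z - k%:Z)) <= D * r ^+ k * modulus (v (- i%:Z)) /\
  modulus (v (i%:Z + k%:Z)) <= D * r ^+ k * modulus (v i%:Z).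

Let r0 : 0 <= r. Proof. by case/andP: r01. Qed.

Lemma past_seqspace k x :
  exists2 z : X, (forall n, z n = past k x n) & rnorm z <= D * r ^+ k * rnorm x.
Proof.
apply: (@seqspace_dom _ _ s (past k x) (D * r ^+ k) k%:Z) => [|n].
  by rewrite mulr_ge0// exprn_ge0.
rewrite /past; case: ifPn => nk; last first.
  by rewrite modulus0 mulr_ge0 ?modulus_ge0// mulr_ge0// exprn_ge0.
rewrite modulusM ler_wpM2r ?modulus_ge0// modulusM modulusV.
rewrite ler_pdivrMr ?modulus_fixed_seq_gt0//.
have [+ _] := dich `|(n + k%:Z)%R|%N k.
have -> : - `|(n + k%:Z)%R|%N%:Z = n + k%:Z by lia.
by rewrite addrK.
Qed.

Lemma future_seqspace k x :
  exists2 z : X, (forall n, z n = future k x n) & rnorm z <= D * r ^+ k * rnorm x.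
Proof.
apply: (@seqspace_dom _ _ s (future k x) (D * r ^+ k) (- k%:Z)) => [|n].
  by rewrite mulr_ge0// exprn_ge0.
rewrite /future; case: ifPn => nk.
  by rewrite modulus0 mulr_ge0 ?modulus_ge0// mulr_ge0// exprn_ge0.
rewrite modulusM ler_wpM2r ?modulus_ge0// modulusM modulusV.
rewrite ler_pdivrMr ?modulus_fixed_seq_gt0//.
have [_] := dich `|(n - k%:Z)%R|%N k.
have -> : `|(n - k%:Z)%R|%N%:Z = n - k%:Z by lia.
by rewrite subrK.
Qed.

(* The bounded solution of [u (j + 1) = B (u j) + d j]. *)
Definition green (d : int -> X) (j n : int) : K :=
  \sum_(k < `|n|.+1) (past k (d (j - 1 - k%:Z)) n - future k.+1 (d (j + k%:Z)) n).

Lemma greenE d j (n : int) N : (`|n| < N)%N -> green d j n =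
  \sum_(k < N) (past k (d (j - 1 - k%:Z)) n - future k.+1 (d (j + k%:Z)) n).
Proof.
move=> nN; rewrite /green -(subnKC nN) big_split_ord /=.
rewrite [X in _ = _ + X]big1 ?addr0// => i _.
by rewrite past_eq0 ?future_eq0 ?subrr//; lia.
Qed.

(** Applying [B] raises the index of the past terms and lowers that of the future ones, so the two
    sides differ by telescoping sums. The terms of index [0] add up to [d j], and those of index [N]
    vanish because [N] exceeds [|n|]. *)
Lemma green_step d j n : green d (j + 1) n = w (n + 1) * green d j (n + 1) + d j n.
Proof.
set N := (`|n| + `|(n + 1)%R|).+1.
rewrite (@greenE _ _ _ N) ?(@greenE _ _ (n + 1) N) ?ltnS ?leq_addr ?leq_addl//.
pose p k := past k (d (j - k%:Z)) n; pose f k := future k (d (j + k%:Z)) n.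
have -> : \sum_(k < N) (past k (d (j + 1 - 1 - k%:Z)) n -
    future k.+1 (d (j + 1 + k%:Z)) n) = \sum_(k < N) (p k - f k.+1).
  apply: eq_bigr => k _; rewrite addrK /p /f.
  by have -> : j + 1 + k%:Z = j + k.+1%:Z by lia.
have -> : w (n + 1) * \sum_(k < N) (past k (d (j - 1 - k%:Z)) (n + 1) -
    future k.+1 (d (j + k%:Z)) (n + 1)) = \sum_(k < N) (p k.+1 - f k).
  rewrite mulr_sumr; apply: eq_bigr => k _; rewrite mulrBr pastS futureS /p /f.
  by have -> : j - 1 - k%:Z = j - k.+1%:Z by lia.
have tel (h : nat -> K) : \sum_(k < N) h k - \sum_(k < N) h k.+1 = h 0%N - h N.
  have := telescope_sumr h (leq0n N); rewrite big_mkord => hN.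
  by rewrite -sumrB -[RHS]opprB -hN -sumrN; apply: eq_bigr => k _; rewrite opprB.
rewrite !sumrB; have := tel p; have := tel f.
have -> : p N = 0 by rewrite /p past_eq0// /N; lia.
have -> : f N = 0 by rewrite /f future_eq0// /N; lia.
rewrite !subr0 -(past0D_future0 (d j) n) => hf hp.
have -> : past 0 (d j) n = p 0%N by rewrite /p subr0.
have -> : future 0 (d j) n = f 0%N by rewrite /f addr0.
by rewrite -hf -hp; ring.
Qed.

Lemma green_seqspace d (e : R) : 0 <= e -> (forall j, rnorm (d j) <= e) ->
  forall j, exists2 u : X, (forall n, u n = green d j n) &
    rnorm u <= 2 * D * e / (1 - r).
Proof.
move=> e0 de j.
have /choice[z zP] (k : nat) : exists z : X,
    (forall n, z n = past k (d (j - 1 - k%:Z)) n - future k.+1 (d (j + k%:Z)) n) /\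
    rnorm z <= 2 * D * e * r ^+ k.
  have [a aE an] := past_seqspace k (d (j - 1 - k%:Z)).
  have [b bE bn] := future_seqspace k.+1 (d (j + k%:Z)).
  exists (a - b); split; first by move=> n; rewrite seqspaceBE aE bE.
  have Dr : 0 <= D * r ^+ k by rewrite mulr_ge0// exprn_ge0.
  rewrite (le_trans (rnormB _ _))//.
  have -> : 2 * D * e * r ^+ k = D * r ^+ k * e + D * r ^+ k * e by ring.
  rewrite lerD ?(le_trans an) ?(le_trans bn)// ?ler_wpM2l//.
  rewrite ler_pM ?rnorm_ge0 ?mulr_ge0 ?exprn_ge0// ler_wpM2l// exprS.
  by rewrite ler_piMl ?exprn_ge0//; case/andP: r01 => _ /ltW.
apply: (@seqspace_series _ _ _ z) => //.
- by rewrite !mulr_ge0.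
- by move=> k; have [] := zP k.
by move=> n N nN; rewrite (greenE _ _ nN); apply: eq_bigr => k _; have [->] := zP k.
Qed.

(** Subtracting the Green solution [u] for the errors of [x] leaves an orbit. The Green function
    commutes with translation in time, so a period of [x] is one of the errors, of [u] and of the
    orbit. *)
Lemma dichotomy_shadow (e : R) : 0 < e -> exists2 d : R, 0 < d &
  forall x : int -> X, (forall j, rnorm (B (x j) - x (j + 1)) < d) ->
    exists2 a : X, (forall j, rnorm (x j - opow B j a) < e) &
      forall p : nat, (forall j, x (j + p%:Z) = x j) -> iter p B a = a.
Proof.
move=> e0; have r1 : 0 < 1 - r by case/andP: r01 => _; rewrite subr_gt0.
have D1 : 0 < 2 * D + 1 by rewrite ltr_wpDl// mulr_ge0.
(* The Green bound becomes [e] times [2 * D / (2 * D + 1)], strictly below [e]. *)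
exists (e * (1 - r) / (2 * D + 1)); first by rewrite divr_gt0// mulr_gt0.
move=> x xd; pose d j := x (j + 1) - B (x j).
have dd j : rnorm (d j) <= e * (1 - r) / (2 * D + 1).
  by rewrite rnorm_subC ltW.
have d0 : 0 <= e * (1 - r) / (2 * D + 1) by rewrite (le_trans _ (dd 0))// rnorm_ge0.
have /choice[u uP] j : exists u : X, (forall n, u n = green d j n) /\ rnorm u < e.
  have [u uE un] := green_seqspace d0 dd j; exists u; split => //.
  apply: le_lt_trans un _; rewrite ltr_pdivrMr// mulrA ltr_pdivrMr//.
  by rewrite -[ltRHS]mulrC ltr_pM2r ?ltrDl// mulr_gt0.
have uE j n : u j n = green d j n by have [-> _] := uP j.
have orb j : x (j + 1) - u (j + 1) = B (x j - u j).
  apply: seqspaceP => n; rewrite bshiftE !seqspaceBE !uE green_step.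
  have -> : d j n = x (j + 1) n - w (n + 1) * x j (n + 1) by [].
  by ring.
have opw j : x j - u j = opow B j (x 0 - u 0) by exact: (opow_orbit orb).
exists (x 0 - u 0) => [j|p xp].
  by rewrite -opw opprB addrCA subrr addr0; have [] := uP j.
have -> : iter p B (x 0 - u 0) = x p%:Z - u p%:Z by rewrite opw.
have -> : x p%:Z = x 0 by rewrite -(xp 0) add0r.
congr (_ - _); apply: seqspaceP => n; rewrite !uE /green.
have dp j : d (j + p%:Z) = d j by rewrite /d addrAC !xp.
apply: eq_bigr => k _; congr (past _ _ _ - future _ _ _).
  by rewrite -[RHS]dp; congr d; lia.
by rewrite -[RHS]dp; congr d; lia.
Qed.

End shadowing.

(** * The two alternatives *)

Lemma dense_per_shadowing (R : realType) (F : scalar_kind) (s : space_kind R)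
    (w : int -> scalar_field R F)
    (wb : bounded_weight w) (wi : bounded_below_weight w) :
  let B := bshift s wb wi in
  in_seqspace s (fixed_seq w) -> periodic_shadowing B <-> shadowing B.
Proof.
move=> B vs.
(* The shadowing point built from the dichotomy serves both properties, so either of them yields the
   other through the weak one. *)
have weakP : weak_periodic_shadowing s wb wi -> shadowing B /\ periodic_shadowing B.
  move=> /(gain_sum_le vs)/(exponential_dichotomy_gain wi vs)[D [r [D0 r01 dich]]].
  have H := dichotomy_shadow s wb wi D0 r01 dich.
  split.
    apply/shadowing_rnorm => e /H[d d0 xP]; exists d => // x /xP[a ax _].
    by exists a.
  apply/periodic_shadowing_rnorm => e /H[d d0 xP]; exists d => // x /xP[a ax ap].
  by move=> [p p0 xp]; exists a => //; exists p => //; exact: ap.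
by split=> [/periodic_shadowing_weak/weakP[]|/shadowing_weak/weakP[]].
Qed.

Theorem theorem4p11 (R : realType) (F : scalar_kind) (s : space_kind R)
    (w : int -> scalar_field R F)
    (w_bounded : bounded_weight w) (w_bounded_below : bounded_below_weight w) :
  let B := bshift s w_bounded w_bounded_below in
  (dense (Per B) /\ (periodic_shadowing B <-> shadowing B)) \/
  [/\ Per B = [set 0 : seqspace F s],
      periodic_shadowing B <-> small_orbit_condition B &
      small_orbit_condition B -> weight_condition w].
Proof.
move=> B; have [vs|vs] := pselect (in_seqspace s (fixed_seq w)); [left|right].
  by split; [exact: per_shift_dense|exact: dense_per_shadowing].
have per0 : Per B = [set 0] by exact: per_shift_trivial.
split=> //; last by move=> /small_orbit_loops; exact: small_loops_weight_condition.
split=> [/(periodic_shadowing_small_loops per0)/small_orbit_loops//|].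
by move=> /small_orbit_loops/small_loops_periodic_shadowing.
Qed.
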